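(* Let $\mu\in\mathbf C$, $\mu\ne4$, and suppose $\phi\in{\bf\Phi}_\mu$ is such that, under a specific identification of $\Omega$ with $\mathbf Q\cup\{\frac10\}$, $\Omega_\phi(2)=\{X_{\frac10}\}$ and $\phi(X_{\frac10})\in(-2,2)$. Then $$\lim_{N\rightarrow\infty}\Re\bigg(\frac{\sum_{r\in\mathbf Q\cap(0,N]}{\mathfrak h}(\phi(X_r))}{N}\bigg)=0,$$ where $N$ ranges over positive integers, and there exists an increasing sequence $(N_k)_{k=1}^\infty$ of positive integers such that $$\lim_{k\rightarrow\infty}\ \sum_{r\in\mathbf Q\cap(0,N_k]}{\mathfrak h}(\phi(X_r))=0\mod 2\pi i,$$ where ${\mathfrak h}=h$ if $\mu=0$, and ${\mathfrak h}={\mathfrak h}_{\mu-2}$ if $\mu\ne0$.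
   Context: $\Sigma$ is the binary (trivalent) tree in the hyperbolic plane dual to the Farey tessellation of the upper half plane, and $\Omega$ is its set of complementary regions (closures of connected components of the complement of $\Sigma$). $\Omega$ is identified with $\mathbf Q\cup\{\infty\}$, $\infty=\frac10$; the region corresponding to $r$ is written $X_r$. Two elements $\frac pq,\frac{p'}{q'}$ of $\mathbf Q\cup\{\infty\}$ (in lowest terms) are Farey neighbors if $|pq'-p'q|=1$. Two regions $X_r,X_s$ share an edge of $\Sigma$ iff $r,s$ are Farey neighbors, and three regions meet at a vertex of $\Sigma$ iff the corresponding elements are pairwise Farey neighbors. For an edge $e=X\cap Y$, we write $e\leftrightarrow(X,Y;Z,W)$ if $Z,W$ are the two regions such that $e\cap Z$ and $e\cap W$ are the endpoints of $e$ (i.e. the two regions which meet both $X$ and $Y$ at an endpoint of $e$). A $\mu$-Markoff map is a map $\phi:\Omega\to\mathbf C$ such that (a) for any three regions $X,Y,Z$ meeting at a vertex, $(x,y,z)=(\phi(X),\phi(Y),\phi(Z))$ satisfies $x^2+y^2+z^2-xyz=\mu$; and (b) for every edge $e\leftrightarrow(X,Y;Z,W)$, $\phi(X)\phi(Y)=\phi(Z)+\phi(W)$. ${\bf\Phi}_\mu$ denotes the set of all $\mu$-Markoff maps. $\Omega_\phi(2)=\{X\in\Omega:|\phi(X)|\le2\}$. Branch conventions for $u\in\mathbf C$: $\sqrt u$ has positive real part if $u\notin(-\infty,0]$ and positive imaginary part if $u\in(-\infty,0)$; $\log u$ ($u\ne0$) has imaginary part in $(-\pi,\pi]$; $\cosh^{-1}(u)$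 has real part $\ge0$ and imaginary part in $(-\pi,\pi]$, and has imaginary part in $[0,\pi]$ when its real part is $0$. Define, for $x\in\mathbf C\setminus\{0\}$, $h(x)=\frac12\Big(1-\sqrt{1-\frac4{x^2}}\,\Big)$, and, for $\tau\ne\pm2$ with $\nu=\cosh^{-1}(-\tau/2)$, $${\mathfrak h}_{\tau}(x)=\log\frac{1+(e^{\nu}-1)h(x)}{1+(e^{-\nu}-1)h(x)},\qquad x\neq 0,\ \pm\sqrt{\tau+2}.$$ A limit ''$=0\mod 2\pi i$'' is a limit in $\mathbf C/2\pi i\mathbf Z$. *)

(* Defs.v *)
From HB Require Import structures.
From mathcomp Require Import all_boot all_order all_algebra.
From mathcomp Require Import all_classical all_reals all_analysis.
From mathcomp Require Import finmap complex generic_quotient.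
From mathcomp.analysis.showcase Require Import summability.

Set Implicit Arguments.
Unset Strict Implicit.
Unset Printing Implicit Defensive.

Import Order.TTheory GRing.Theory Num.Theory numFieldNormedType.Exports.

Local Open Scope classical_set_scope.
Local Open Scope ring_scope.
Local Open Scope complex_scope.
Local Open Scope quotient_scope.

(* Q together with infinity = 1/0, which is [None]. *)
Definition Qinf : Type := option rat.

Definition num_inf (r : Qinf) : int := if r is Some q then numq q else 1.
Definition den_inf (r : Qinf) : int := if r is Some q then denq q else 0.

Definition farey_neighbors (r s : Qinf) : bool :=
  `|num_inf r * den_inf s - num_inf s * den_inf r| == 1.

(* A region of the complement of the tree Sigma is the same thing as a vertex
   of the Farey tessellation to which Sigma is dual, that is, a cusp in
   Q u {1/0}; the incidences of Sigma are those of the tessellation. *)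
Definition Omega : Type := Qinf.

Definition share_edge (X Y : Omega) : bool := farey_neighbors X Y.

Definition meet_at_vertex (X Y Z : Omega) : bool :=
  [&& share_edge X Y, share_edge Y Z & share_edge X Z].

(* e <-> (X, Y; Z, W): the edge e is the intersection of X and Y, and Z, W are
   the two regions at its endpoints. *)
Definition edge_regions (X Y Z W : Omega) : Prop :=
  [/\ share_edge X Y, meet_at_vertex X Y Z, meet_at_vertex X Y W & Z <> W].

(* An identification r |-> X_r of Q u {1/0} with Omega. It need not be the
   tautological one: any two differ by an automorphism of the tree. *)
Definition identification (X : Qinf -> Omega) : Prop :=
  bijective X /\ forall r s, share_edge (X r) (X s) = farey_neighbors r s.

(* The usual topology of the complex plane: [R[i]] as a normed module over
   itself. *)
HB.instance Definition _ (R : realType) := NormedModule.copy R[i] R[i]^o.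

Section Complex.
Variable R : realType.
Implicit Types (x z u w tau : R[i]).

Definition cexp z : R[i] :=
  (expR (complex.Re z) * cos (complex.Im z))
    +i* (expR (complex.Re z) * sin (complex.Im z)).

Definition cmod z : R := Num.sqrt (complex.Re z ^+ 2 + complex.Im z ^+ 2).

(* The argument in ]-pi, pi], for z != 0. *)
Definition carg z : R :=
  if complex.Im z < 0 then - acos (complex.Re z / cmod z)
  else acos (complex.Re z / cmod z).

Definition clog z : R[i] := ln (cmod z) +i* carg z.

Definition ccosh w : R[i] := (cexp w + cexp (- w)) / 2.

(* Exactly one w satisfies the condition. *)
Definition cacosh u : R[i] :=
  xget 0 [set w | [/\ ccosh w = u,
                      0 <= complex.Re w,
                      - trigo.pi < complex.Im w <= trigo.pi &
                      complex.Re w = 0 -> 0 <= complex.Im w]].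

(* [sqrtc] is the principal square root: its real part is positive off
   ]-oo, 0], and its imaginary part is positive on ]-oo, 0[. *)
Definition hfun x : R[i] := (1 - sqrtc (1 - 4 / x ^+ 2)) / 2.

Definition hfun_tau tau x : R[i] :=
  let nu := cacosh (- tau / 2) in
  clog ((1 + (cexp nu - 1) * hfun x) / (1 + (cexp (- nu) - 1) * hfun x)).

End Complex.

Section Mod2pii.
Variable R : realType.

Definition eq_mod_2pii (x y : R[i]) : bool :=
  `[< exists m : int, x - y = m%:~R * (0 +i* (2 * trigo.pi)) >].

Lemma eq_mod_2pii_is_equiv : equiv_class_of eq_mod_2pii.
Proof.
split=> [x|x y|y x z].
- by apply/asboolP; exists 0; rewrite subrr mul0r.
- by apply/asbool_equiv_eq; split=> -[m xy]; exists (- m);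
    rewrite -opprB xy mulrNz mulNr.
- move=> /asboolP[m xy] /asboolP[n yz]; apply/asboolP; exists (m + n).
  by rewrite mulrzDr mulrDl -xy -yz addrA subrK.
Qed.

Canonical eq_mod_2pii_equiv := EquivRelPack eq_mod_2pii_is_equiv.

Definition C_mod_2pii := quotient_topology {eq_quot eq_mod_2pii}.

Definition to_mod_2pii (x : R[i]) : C_mod_2pii := \pi_{eq_quot eq_mod_2pii} x.

End Mod2pii.

Section Markoff.
Variable R : realType.
Implicit Types (mu : R[i]) (phi : Omega -> R[i]).

Definition markoff_map mu phi : Prop :=
  (forall X Y Z : Omega, meet_at_vertex X Y Z ->
     phi X ^+ 2 + phi Y ^+ 2 + phi Z ^+ 2 - phi X * phi Y * phi Z = mu) /\
  (forall X Y Z W : Omega, edge_regions X Y Z W ->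
     phi X * phi Y = phi Z + phi W).

Definition Omega2 phi : set Omega := [set X | `|phi X| <= 2].

Definition frakh mu (x : R[i]) : R[i] :=
  if mu == 0 then hfun x else hfun_tau (mu - 2) x.

(* The finite partial sums of the family (F r), r in Q \cap ]0, N]. Its sum is
   their limit along the directed set of finite subsets of Q \cap ]0, N]. *)
Definition rat_partial_sum (F : rat -> R[i]) (N : nat) :=
  partial_sum (fun r : {r : rat | 0 < r <= N%:R} => F (val r)).

Definition rat_sum (F : rat -> R[i]) (N : nat) : R[i] :=
  summability.sum (fun r : {r : rat | 0 < r <= N%:R} => F (val r)).

End Markoff.

Arguments rat_partial_sum {R} F N A.

(* Main.v *)
(* Write y_n for the value at X_n, x = 2 cos(theta) for the value at X_(1/0),
   and t = e^nu, so that t + 1/t = 2 - mu; with p = 1 + (t - 1) h,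
   q = 1 + (1/t - 1) h one has p q = 1 - mu/z^2 =: D and
   exp (h_tau) = p/q = p^2/D.

   To a Farey edge (a, b) with third value w on one side attach
   G = 1 + (t - 1) w/(a b).  The vertex relation says that G D(m) is the product
   of the values of G on the two edges created by inserting the mediant m.
   Since G is p(a) p(b) (1 + O(1/max(|a|,|b|)^2)) and the values grow
   exponentially in the denominators, inserting mediants for ever shows that
   G(y_n, y_(n+1), x) is p(y_n) p(y_(n+1)) times the product of p^2/D over all
   rationals of ]n, n+1[.

   The edge and vertex relations around X_(1/0) make the product of these
   identities over 0 <= n < N telescope: the exponential of the sum over ]0, N]
   is V_N/V_0, where V_n is an explicit continuous function of (y_n, y_(n+1)),
   bounded and bounded away from 0.  The sequence y_n is a combination of
   cos(n theta) and sin(n theta), hence is bounded and returns arbitrarily close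
   to (y_0, y_1).  The case mu = 0 is the same computation with
   G = exp(w/(2 a b)), p = exp(h/2), D = 1. *)
Require Import Defs.
From HB Require Import structures.
From mathcomp Require Import all_boot all_order all_algebra.
From mathcomp Require Import all_classical all_reals all_analysis.
From mathcomp Require Import finmap complex generic_quotient.
From mathcomp.analysis.showcase Require Import summability.
From mathcomp Require Import ring lra zify.

Set Implicit Arguments.
Unset Strict Implicit.
Unset Printing Implicit Defensive.

Import Order.TTheory GRing.Theory Num.Theory numFieldNormedType.Exports.

Local Open Scope classical_set_scope.
Local Open Scope ring_scope.
Local Open Scope complex_scope.

(** * The modulus as a real number *)

Section Modulus.
Variable R : realType.
Implicit Types (x y z : R[i]) (a b : R).

(** Working with exponentials of the sums makes the branch of the logarithm irrelevant and turns the
    limit modulo 2 pi i into a limit in C.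

    Two kinds of uniformity are kept apart. The product over one unit interval needs an exponential
    growth rate [rho], which may depend on N. The bounds on V_n must hold for all n at once, so p
    and q have to stay away from 0 uniformly along the integers. This comes from y_n^2 - mu =
    y_(n-1) y_(n+1) - x^2: the factors on the right exceed 2 in modulus and |x| < 2, so the left
    side has modulus at least 4 - x^2, and D(y_n) = (y_n^2 - mu)/y_n^2 is p q.

    V_n is built from the values of G on the edges between X_(1/0) and X_n, one for each side. They
    are multiplied by x, because x may vanish. The relation obtained by crossing the triangle
    (X_(1/0), X_n, X_(n+1)) is again the vertex relation, read from another edge of the triangle;
    this is why the product telescopes. *)

Lemma normE z : `|z| = (cmod z)%:C.
Proof. exact: normc_def. Qed.

Lemma cmod_ge0 z : 0 <= cmod z.
Proof. exact: sqrtr_ge0. Qed.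

Lemma cmodM x y : cmod (x * y) = cmod x * cmod y.
Proof. by apply: (@complexI R); rewrite rmorphM /= -!normE normrM. Qed.

Lemma cmodV x : cmod x^-1 = (cmod x)^-1.
Proof. by apply: (@complexI R); rewrite fmorphV /= -!normE normfV. Qed.

Lemma cmod_div x y : cmod (x / y) = cmod x / cmod y.
Proof. by rewrite cmodM cmodV. Qed.

Lemma cmodX x n : cmod (x ^+ n) = cmod x ^+ n.
Proof. by apply: (@complexI R); rewrite rmorphXn /= -!normE normrX. Qed.

Lemma cmodN x : cmod (- x) = cmod x.
Proof. by apply: (@complexI R); rewrite -!normE normrN. Qed.

Lemma cmodBC x y : cmod (x - y) = cmod (y - x).
Proof. by rewrite -cmodN opprB. Qed.

Lemma cmod0 : cmod (0 : R[i]) = 0.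
Proof. by apply: (@complexI R); rewrite -normE normr0. Qed.

Lemma cmod_real a : cmod a%:C = `|a|.
Proof. by rewrite /cmod /= expr0n addr0 sqrtr_sqr. Qed.

Lemma cmod1 : cmod (1 : R[i]) = 1.
Proof. by apply: (@complexI R); rewrite -normE normr1. Qed.

Lemma cmod_nat n : cmod (n%:R : R[i]) = n%:R.
Proof. by apply: (@complexI R); rewrite -normE normr_nat rmorph_nat. Qed.

Lemma cmod_eq0 z : (cmod z == 0) = (z == 0).
Proof. by rewrite -(inj_eq (@complexI R)) -normE normr_eq0. Qed.

Lemma cmod_gt0 z : (0 < cmod z) = (z != 0).
Proof. by rewrite lt_def cmod_ge0 andbT cmod_eq0. Qed.

Lemma le_cmodD x y : cmod (x + y) <= cmod x + cmod y.
Proof. by rewrite -lecR rmorphD /= -!normE ler_normD. Qed.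

Lemma le_cmodB x y : cmod (x - y) <= cmod x + cmod y.
Proof. by rewrite -(cmodN y) le_cmodD. Qed.

Lemma ge_cmodB x y : cmod x - cmod y <= cmod (x - y).
Proof. by rewrite lerBlDr -{1}(subrK y x) le_cmodD. Qed.

Lemma sqr_cmod z : cmod z ^+ 2 = complex.Re z ^+ 2 + complex.Im z ^+ 2.
Proof. by rewrite sqr_sqrtr // addr_ge0 // sqr_ge0. Qed.

Lemma Re_le_cmod z : `|complex.Re z| <= cmod z.
Proof. by rewrite -sqrtr_sqr ler_wsqrtr // lerDl sqr_ge0. Qed.

Lemma Im_le_cmod z : `|complex.Im z| <= cmod z.
Proof. by rewrite -sqrtr_sqr ler_wsqrtr // lerDr sqr_ge0. Qed.

Lemma cmod_le_ReIm z : cmod z <= `|complex.Re z| + `|complex.Im z|.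
Proof.
rewrite -(ler_pXn2r (n:=2)) ?nnegrE ?cmod_ge0 ?addr_ge0 //.
rewrite sqr_cmod sqrrD !real_normK ?num_real // addrAC lerDl.
by rewrite mulrn_wge0 // mulr_ge0.
Qed.

Lemma ReD x y : complex.Re (x + y) = complex.Re x + complex.Re y.
Proof. by case: x; case: y. Qed.
Lemma ReN x : complex.Re (- x) = - complex.Re x.
Proof. by case: x. Qed.
Lemma ImD x y : complex.Im (x + y) = complex.Im x + complex.Im y.
Proof. by case: x; case: y. Qed.
Lemma ImN x : complex.Im (- x) = - complex.Im x.
Proof. by case: x. Qed.

Lemma cvg_cmodP {T : Type} (F : set_system T) {FF : Filter F} (f : T -> R[i]) (l : R[i]) :
  f @ F --> l <-> (fun i => cmod (f i - l)) @ F --> (0 : R).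
Proof.
split.
  move/cvgrPdist_lt => fl; apply/cvgrPdist_lt => e e0.
  have := fl e%:C; rewrite ltcR => /(_ e0); apply: filterS => i.
  by rewrite distrC normE ltcR sub0r normrN ger0_norm ?cmod_ge0.
(* The radius is a positive element of [R[i]], and the order there forces its imaginary part to be
   0. *)
move/cvgrPdist_lt => fl; apply/cvgrPdist_lt => -[e e'].
rewrite ltcE /= => /andP[/eqP -> e0].
have := fl e e0; apply: filterS => i.
by rewrite sub0r normrN ger0_norm ?cmod_ge0 // distrC normE ltcR.
Qed.

End Modulus.

(** * The complex exponential and its continuity *)

Section Exponential.
Variable R : realType.
Implicit Types (x y z : R[i]) (a b : R).
Local Notation pi := (@trigo.pi R).

Lemma cexpD x y : cexp (x + y) = cexp x * cexp y.
Proof.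
case: x => a b; case: y => c d; rewrite /cexp /= expRD cosD sinD.
by apply/eqP; rewrite eq_complex /=; apply/andP; split; apply/eqP; ring.
Qed.

Lemma cexp0 : cexp (0 : R[i]) = 1.
Proof. by rewrite /cexp /= expR0 cos0 sin0 mul1r mulr0. Qed.

Lemma cmod_cexp x : cmod (cexp x) = expR (complex.Re x).
Proof.
by rewrite /cmod /= !exprMn -mulrDr cos2Dsin2 mulr1 sqrtr_sqr ger0_norm ?expR_ge0.
Qed.

Lemma cexp_neq0 x : cexp x != 0.
Proof. by rewrite -cmod_gt0 cmod_cexp expR_gt0. Qed.

Lemma cexpN x : cexp (- x) = (cexp x)^-1.
Proof.
apply: (mulfI (cexp_neq0 x)).
by rewrite -cexpD subrr cexp0 divff ?cexp_neq0.
Qed.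

Lemma cexpB x y : cexp (x - y) = cexp x / cexp y.
Proof. by rewrite cexpD cexpN. Qed.

Lemma cexp_sum (I : Type) (s : seq I) (P : pred I) (F : I -> R[i]) :
  cexp (\sum_(i <- s | P i) F i) = \prod_(i <- s | P i) cexp (F i).
Proof. exact: (big_morph _ cexpD cexp0). Qed.

Lemma ltr_mean (f df : R -> R) a b : a < b ->
  (forall c : R, is_derive c (1 : R) f (df c)) ->
  exists2 c, a < c < b & f b - f a = df c * (b - a).
Proof.
move=> ab fdf.
have [|c] := @MVT R f df a b ab (fun c _ => fdf c).
  by apply: derivable_within_continuous => c _; exact: ex_derive.
by rewrite in_itv /= => cab E; exists c.
Qed.

Lemma norm_sin_le a : `|sin a| <= `|a|.
Proof.
have pos b : 0 < b -> `|sin b| <= b.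
  move=> b0; have [c _] := ltr_mean b0 (@is_derive_sin R).
  rewrite sin0 !subr0 => ->; rewrite normrM (gtr0_norm b0).
  by rewrite ler_piMl ?cos_max // ltW.
have [a0|a0|->] := ltgtP a 0; last by rewrite sin0.
  by rewrite -normrN -sinN (ltr0_norm a0) pos // oppr_gt0.
by rewrite (gtr0_norm a0) pos.
Qed.

Lemma norm_cosB1_le a : `|cos a - 1| <= `|a|.
Proof.
have pos b : 0 < b -> `|cos b - 1| <= b.
  move=> b0; have [c _] := ltr_mean b0 (@is_derive_cos R).
  rewrite cos0 !subr0 => ->; rewrite normrM (gtr0_norm b0) normrN.
  by rewrite ler_piMl ?sin_max // ltW.
have [a0|a0|->] := ltgtP a 0; last by rewrite cos0 subrr.
  by rewrite -cosN (ltr0_norm a0) pos // oppr_gt0.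
by rewrite (gtr0_norm a0) pos.
Qed.

(** For 0 < b, sin b = b cos c with 0 < c < b, and cos decreases on [0, pi]. This turns knowledge of
    cos and sin into a bound on the angle itself, both for the argument near 1 and for the kernel of
    [cexp]. *)
Lemma mulr_cos_le_sin a : `|a| <= pi -> `|a| * cos a <= `|sin a|.
Proof.
have pos b : 0 < b -> b <= pi -> b * cos b <= `|sin b|.
  move=> b0 bpi; have [c /andP[c0 cb]] := ltr_mean b0 (@is_derive_sin R).
  rewrite sin0 !subr0 => ->; rewrite normrM (gtr0_norm b0) mulrC.
  apply: ler_wpM2r; first exact: ltW.
  apply: le_trans (ler_norm _); apply: ltW.
  rewrite ltr_cos // in_itv /= ?(ltW b0) ?(ltW c0) //=.
  exact: ltW (lt_le_trans cb _).
have [a0|a0|->] := ltgtP a 0; last by rewrite sin0 normr0 mul0r.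
  by rewrite -cosN -(normrN (sin _)) -sinN (ltr0_norm a0) => ?;
    rewrite pos // oppr_gt0.
by rewrite (gtr0_norm a0) => ?; rewrite pos.
Qed.

Lemma norm_expRB1_le a : `|expR a - 1| <= `|a| * expR `|a|.
Proof.
have e1 : 1 <= expR `|a| by rewrite -expR0 ler_expR.
have [a0|a0|->] := ltgtP a 0; last by rewrite expR0 subrr !normr0 mul0r.
  have [c /andP[ac c0]] := ltr_mean a0 (@is_derive_expR R).
  rewrite expR0 sub0r distrC => ->; rewrite normrM normrN mulrC.
  apply: ler_wpM2l => //; rewrite ger0_norm ?expR_ge0 //.
  by apply: le_trans e1; rewrite -expR0 ler_expR ltW.
have [c /andP[ac c0]] := ltr_mean a0 (@is_derive_expR R).
rewrite expR0 subr0 => ->; rewrite normrM mulrC.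
apply: ler_wpM2l => //; rewrite ger0_norm ?expR_ge0 //.
by rewrite ler_expR (gtr0_norm a0) ltW.
Qed.

(** Split as e^a (e^(ib) - 1) + (e^a - 1). The constant 3 is 2 from cos and sin plus 1 from the real
    exponential. *)
Lemma cmod_cexpB1_le z : cmod (cexp z - 1) <= 3 * cmod z * expR (cmod z).
Proof.
case: z => a b; set z := a +i* b.
have -> : cexp z - 1 = (expR a)%:C * ((cos b - 1) +i* sin b) + (expR a - 1)%:C.
  by apply/eqP; rewrite eq_complex /=; apply/andP; split; apply/eqP; ring.
apply: le_trans (le_cmodD _ _) _.
rewrite cmodM !cmod_real (ger0_norm (expR_ge0 a)).
have ha : `|a| <= cmod z := Re_le_cmod z.
have hb : `|b| <= cmod z := Im_le_cmod z.
have e1 : cmod ((cos b - 1) +i* sin b) <= 2 * cmod z.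
  apply: le_trans (cmod_le_ReIm _) _ => /=.
  have := norm_sin_le b; have := norm_cosB1_le b; lra.
have e2 := norm_expRB1_le a.
have e3 : expR a <= expR (cmod z).
  by rewrite ler_expR (le_trans (ler_norm _)).
have e4 : expR `|a| <= expR (cmod z) by rewrite ler_expR.
have e5 : expR a * cmod ((cos b - 1) +i* sin b) <= expR (cmod z) * (2 * cmod z).
  by apply: ler_pM => //; rewrite ?expR_ge0 ?cmod_ge0.
have e6 : `|a| * expR `|a| <= cmod z * expR (cmod z).
  by apply: ler_pM => //; rewrite ?expR_ge0.
lra.
Qed.

Lemma cvg_cexp {T : Type} (F : set_system T) {FF : Filter F} (f : T -> R[i]) (l : R[i]) :
  f @ F --> l -> (fun i => cexp (f i)) @ F --> cexp l.
Proof.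
move=> /cvg_cmodP fl; apply/cvg_cmodP.
have -> : (fun i => cmod (cexp (f i) - cexp l)) =
   (fun i => expR (complex.Re l) * cmod (cexp (f i - l) - 1)).
  apply/funext => i; rewrite -cmod_cexp -cmodM mulrBr mulr1 -cexpD.
  by rewrite addrCA subrr addr0.
rewrite -[X in _ --> X](mulr0 (expR (complex.Re l))); apply: cvgMr.
apply: (@squeeze_cvgr _ _ _ _ (cst 0)
   (fun i => 3 * cmod (f i - l) * expR (cmod (f i - l)))).
- by apply: nearW => i; rewrite cmod_ge0 cmod_cexpB1_le.
- exact: cvg_cst.
- have -> : (0 : R) = 3 * 0 * expR 0 by rewrite mulr0 mul0r.
  apply: cvgM; first exact: cvgMr.
  by apply: continuous_cvg => //; exact: continuous_expR.
Qed.

End Exponential.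

(** * The principal argument and logarithm *)

Section Logarithm.
Variable R : realType.
Implicit Types (x y z : R[i]) (a b : R).
Local Notation pi := (@trigo.pi R).

Lemma Re_div_cmod_itv z : -1 <= complex.Re z / cmod z <= 1.
Proof.
rewrite -ler_norml normrM normfV (ger0_norm (cmod_ge0 z)).
have [/eqP z0|z0] := boolP (cmod z == 0); first by rewrite z0 invr0 mulr0.
by rewrite ler_pdivrMr ?mul1r ?Re_le_cmod // cmod_gt0 -cmod_eq0.
Qed.

Lemma carg_itv z : z != 0 -> - pi < carg z <= pi.
Proof.
move=> z0; have := Re_div_cmod_itv z; rewrite /carg.
set c := _ / _ => cI.
have c0 := acos_ge0 cI; have c1 := acos_lepi cI; have p0 := @pi_gt0 R.
case: ifP => Imz; last by rewrite c1 (lt_le_trans _ c0) // oppr_lt0.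
apply/andP; split; last by rewrite (le_trans _ (ltW p0)) // oppr_le0.
(* The angle -pi is excluded: it would need [c] = -1, hence a zero imaginary part, against [Imz]. *)
rewrite ltrN2 acos_ltpi //; move/andP: cI => [cN1 ->]; rewrite andbT lt_def cN1 andbT.
apply/negP => /eqP c'; have : c ^+ 2 = 1 by rewrite c' sqrrN expr1n.
rewrite /c expr_div_n => /eqP.
have zn0 : cmod z ^+ 2 != 0 by rewrite expf_neq0 // cmod_eq0.
rewrite -(inj_eq (mulIf zn0)) mul1r divfK // sqr_cmod -subr_eq0 opprD addNKr.
by rewrite oppr_eq0 sqrf_eq0 (lt_eqF Imz).
Qed.

Lemma cos_carg z : cos (carg z) = complex.Re z / cmod z.
Proof.
have cI := Re_div_cmod_itv z; rewrite /carg; case: ifP => _; rewrite ?cosN acosK //.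
Qed.

Lemma sin_carg z : z != 0 -> sin (carg z) = complex.Im z / cmod z.
Proof.
move=> z0; have cI := Re_div_cmod_itv z.
have m0 : 0 < cmod z by rewrite cmod_gt0.
have E : sin (acos (complex.Re z / cmod z)) = `|complex.Im z| / cmod z.
  rewrite sin_acos // -[X in 1 - X]/((_ / _) ^+ 2) expr_div_n.
  have -> : 1 - complex.Re z ^+ 2 / cmod z ^+ 2 = (complex.Im z / cmod z) ^+ 2.
    have := sqr_cmod z; rewrite expr_div_n => h.
    have -> : complex.Re z ^+ 2 = cmod z ^+ 2 - complex.Im z ^+ 2 by rewrite h addrK.
    by field; rewrite gt_eqF.
  by rewrite sqrtr_sqr normrM normfV (gtr0_norm m0).
rewrite /carg; case: ltP => Imz; rewrite ?sinN E.
  by rewrite (ltr0_norm Imz) mulNr opprK.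
by rewrite ger0_norm.
Qed.

Lemma clogK z : z != 0 -> cexp (clog z) = z.
Proof.
move=> z0; have m0 : 0 < cmod z by rewrite cmod_gt0.
rewrite /cexp /clog /= lnK ?posrE // cos_carg sin_carg //.
rewrite !(mulrC (cmod z)) !divfK ?gt_eqF //; by case: z {z0 m0}.
Qed.

Lemma cmod_clog_le z : z != 0 -> cmod (clog z) <= `|ln (cmod z)| + pi.
Proof.
move=> z0; apply: le_trans (cmod_le_ReIm _) _ => /=; rewrite lerD2l ler_norml.
by case/andP: (carg_itv z0) => /ltW -> ->.
Qed.

(** The real part is bounded by ln(1 + u) <= u applied to |z| and to 1/|z|. For the argument,
    [mulr_cos_le_sin] gives |arg z| Re z <= |Im z|, where Re z >= 1/2. Each part contributes 2. *)
Lemma cmod_clog_near1 z : cmod (z - 1) <= 1 / 2 -> cmod (clog z) <= 4 * cmod (z - 1).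
Proof.
set e := cmod _ => e2.
have e0 : 0 <= e := cmod_ge0 _.
have z1 : cmod z <= 1 + e.
  by rewrite -{1}(subrK 1 z) (le_trans (le_cmodD _ _)) // cmod1 addrC.
have z2 : 1 - e <= cmod z.
  have := ge_cmodB (1 : R[i]) (1 - z); rewrite cmod1 (cmodBC 1 z) -/e.
  by rewrite opprB addrCA subrr addr0.
have m0 : 0 < cmod z by lra.
have zn0 : z != 0 by rewrite -cmod_gt0.
have re : 1 / 2 <= complex.Re z.
  have := Re_le_cmod (z - 1); rewrite ReD ReN /= -/e ler_norml; lra.
have im : `|complex.Im z| <= e.
  have := Im_le_cmod (z - 1); by rewrite ImD ImN /= oppr0 addr0.
apply: le_trans (cmod_le_ReIm _) _ => /=.
have l1 : `|ln (cmod z)| <= 2 * e.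
  rewrite ler_norml; apply/andP; split; last first.
    have := @le_ln1Dx R (cmod z - 1); rewrite addrCA subrr addr0; lra.
  have := @le_ln1Dx R ((cmod z)^-1 - 1); rewrite addrCA subrr addr0.
  rewrite lnV ?posrE //.
  have : (cmod z)^-1 - 1 <= 2 * e.
    rewrite lerBlDr -[leLHS]mul1r ler_pdivrMr //; nra.
  have : -1 < (cmod z)^-1 - 1 by rewrite ltrBDr addNr invr_gt0.
  lra.
have l2 : `|carg z| <= 2 * e.
  have /andP[c1 c2] := carg_itv zn0.
  have : `|carg z| <= pi by rewrite ler_norml c2 (ltW c1).
  move/mulr_cos_le_sin; rewrite cos_carg sin_carg // normrM normfV.
  rewrite (gtr0_norm m0) mulrA ler_pM2r ?invr_gt0 // => h.
  have : `|carg z| * (1 / 2) <= `|carg z| * complex.Re z by rewrite ler_wpM2l.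
  lra.
lra.
Qed.

End Logarithm.

(** * The inverse hyperbolic cosine *)

Section Acosh.
Variable R : realType.
Implicit Types (u t w : R[i]).
Local Notation pi := (@trigo.pi R).

Lemma ccoshN w : ccosh (- w) = ccosh w.
Proof. by rewrite /ccosh opprK addrC. Qed.

(** What has to be shown is that the set under [xget] is inhabited. The roots of t^2 - 2 u t + 1
    have product 1, so one has modulus at least 1 and its logarithm has nonnegative real part. *)
Lemma cacoshK u : ccosh (cacosh u) = u.
Proof.
have [t t1 [t0 tu]] : exists2 t, 1 <= cmod t & t != 0 /\ (t + t^-1) / 2 = u.
  pose s := sqrtc (u ^+ 2 - 1).
  have s2 : (u + s) * (u - s) = 1.
    by rewrite mulrC -subr_sqr sqr_sqrtc subKr.
  have n2 : (2 : R[i]) != 0 by rewrite pnatr_eq0.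
  have p0 : u + s != 0 by apply: contra_eq_neq s2 => ->; rewrite mul0r eq_sym oner_eq0.
  have m0 : u - s != 0 by apply: contra_eq_neq s2 => ->; rewrite mulr0 eq_sym oner_eq0.
  have ip : (u + s)^-1 = u - s by apply: (mulfI p0); rewrite divff.
  have im : (u - s)^-1 = u + s by rewrite -ip invrK.
  have [h|h] := leP 1 (cmod (u + s)).
    exists (u + s) => //; split=> //; rewrite ip; by field.
  exists (u - s); last by split=> //; rewrite im; field.
  rewrite -ip cmodV invf_ge1 ?cmod_gt0 //; exact: ltW.
have ct : ccosh (clog t) = u by rewrite /ccosh cexpN clogK.
have /andP[a1 a2] := carg_itv t0.
rewrite /cacosh; case: xgetP => [w _ [] //|none]; exfalso.
have lnt : 0 <= ln (cmod t) by exact: ln_ge0.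
have [a0|a0] := leP 0 (carg t).
  by apply: (none (clog t)); split=> //=; rewrite a1.
(* When [t] is on the unit circle with negative argument, [clog t] breaks the last normalization;
   its opposite has the same [ccosh] and meets it. *)
have [l0|l0] := eqVneq (ln (cmod t)) 0.
  apply: (none (- clog t)); split; rewrite ?ccoshN //.
  - by rewrite ReN /= l0 oppr0.
  - by rewrite ImN /=; apply/andP; split; lra.
  - by move=> _; rewrite ImN /=; lra.
by apply: (none (clog t)); split=> //=; rewrite ?a1 // => /eqP; rewrite (negbTE l0).
Qed.

End Acosh.

(** * Limits modulo 2 pi i *)

Section ModTwoPiI.
Variable R : realType.
Local Notation pi := (@trigo.pi R).

Local Notation period := (0 +i* (2 * pi) : R[i]).

Lemma cexp_int_period (m : int) : cexp (m%:~R * period) = 1 :> R[i].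
Proof.
have e1 : cexp period = 1.
  by rewrite /cexp /= expR0 !mul1r mulr_natl cos2pi sin2pi.
have en n : cexp (n%:R * period) = 1.
  elim: n => [|n IHn]; first by rewrite mul0r cexp0.
  by rewrite -natr1 mulrDl mul1r cexpD IHn e1 mulr1.
case: m => n; first exact: en.
by rewrite NegzE rmorphN /= mulNr cexpN en invr1.
Qed.

Lemma mod_2pii_repr (z : R[i]) :
  {m : int | `|complex.Im (z - m%:~R * period)| <= pi}.
Proof.
pose f := (complex.Im z + pi) / (2 * pi); exists (Num.floor f).
have p0 := @pi_gt0 R.
have -> : complex.Im (z - (Num.floor f)%:~R * period) =
    complex.Im z - (Num.floor f)%:~R * (2 * pi).
  rewrite ImD ImN -(rmorph_int (real_complex R)) /=; ring.
have /andP[] := floor_itv f.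
rewrite /f ler_pdivlMr ?ltr_pdivrMr ?mulr_gt0 // intrD mulrDl ler_norml; lra.
Qed.

(** After translation the imaginary part b lies in [-pi, pi]; with cos b = 1 and sin b = 0,
    [mulr_cos_le_sin] reads |b| <= 0. *)
Lemma cexp_eq1 (z : R[i]) : cexp z = 1 -> exists m : int, z = m%:~R * period.
Proof.
move=> z1; have [m mpi] := mod_2pii_repr z; exists m.
apply/eqP; rewrite -subr_eq0; move: mpi.
have : cexp (z - m%:~R * period) = 1 by rewrite cexpB z1 cexp_int_period divr1.
case: (z - _) => a b e bpi.
have a0 : a = 0.
  apply: expR_inj; rewrite expR0.
  by have := cmod_cexp (a +i* b); rewrite e cmod1 => /= <-.
move: e; rewrite /cexp /= a0 expR0 !mul1r => -[cb sb].
have := mulr_cos_le_sin bpi; rewrite /= cb sb normr0 mulr1 normr_le0 => /eqP ->.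
by [].
Qed.

Lemma to_mod_2pii_clog (z : R[i]) : to_mod_2pii z = to_mod_2pii (clog (cexp z)).
Proof.
have [m zm] : exists m : int, z - clog (cexp z) = m%:~R * period.
  by apply: cexp_eq1; rewrite cexpB clogK ?divff ?cexp_neq0.
by apply/eqquotP; apply/asboolP; exists m.
Qed.

(** In the quotient [f i] may be replaced by the principal logarithm of its exponential, which tends
    to 0 in C; the projection is continuous. *)
Lemma cvg_to_mod_2pii {T : Type} (F : set_system T) {FF : Filter F} (f : T -> R[i]) :
  (fun i => cexp (f i)) @ F --> (1 : R[i]) ->
  (fun i => to_mod_2pii (f i)) @ F --> to_mod_2pii (0 : R[i]).
Proof.
move=> /cvg_cmodP f1.
under eq_fun do rewrite to_mod_2pii_clog.
suff cl0 : (fun i => clog (cexp (f i))) @ F --> (0 : R[i]).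
  exact: (cvg_comp _ _ cl0 (@pi_continuous _ {eq_quot (@eq_mod_2pii R)}%qT 0)).
apply/cvg_cmodP; under eq_fun do rewrite subr0.
apply: (@squeeze_cvgr _ _ _ _ (cst 0) (fun i => 4 * cmod (cexp (f i) - 1))).
- have : \forall i \near F, cmod (cexp (f i) - 1) <= 1 / 2.
    move/cvgrPdist_le : f1 => /(_ (1 / 2)); rewrite divr_gt0 // => /(_ isT).
    by apply: filterS => i; rewrite sub0r normrN ger0_norm ?cmod_ge0.
  by apply: filterS => i h; rewrite cmod_ge0 cmod_clog_near1.
- exact: cvg_cst.
- have -> : (0 : R) = 4 * 0 by rewrite mulr0.
  exact: cvgMr.
Qed.

End ModTwoPiI.

(** * The function h *)

Section Hfun.
Variable R : realType.
Implicit Types (x y z : R[i]).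

Lemma Re_sqrtc_ge0 z : 0 <= complex.Re (sqrtc z).
Proof. by case: z => a b; rewrite /sqrtc /= sqrtr_ge0. Qed.

(** Since 1 - h = (1 + sqrt(...))/2, this is the choice of the square root. It keeps 1 - h away from
    0 everywhere, across the branch cut as well. *)
Lemma Re_1Bhfun x : 1 / 2 <= complex.Re (1 - hfun x).
Proof.
have -> : 1 - hfun x = (1 / 2)%:C * (1 + sqrtc (1 - 4 / x ^+ 2)).
  have -> : (1 / 2)%:C = 1 / 2 :> R[i].
    by rewrite rmorphM fmorphV rmorph_nat rmorph1.
  have n2 : (2 : R[i]) != 0 by rewrite pnatr_eq0.
  by rewrite /hfun; field.
have := Re_sqrtc_ge0 (1 - 4 / x ^+ 2).
by case: sqrtc => a b /= a0; lra.
Qed.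

(** h and 1 - h are the roots of X^2 - X + x^(-2). The later estimates use this equation and the
    half plane of 1 - h in place of the square root. *)
Lemma hfunM1B x : hfun x * (1 - hfun x) = x ^- 2.
Proof.
have n2 : (2 : R[i]) != 0 by rewrite pnatr_eq0.
have -> : hfun x * (1 - hfun x) = (1 - sqrtc (1 - 4 / x ^+ 2) ^+ 2) / 4.
  by rewrite /hfun; field.
have n4 : (4 : R[i]) != 0 by rewrite pnatr_eq0.
by rewrite sqr_sqrtc subKr mulrAC divff ?mul1r.
Qed.

Lemma cmod_hfun_le x : cmod (hfun x) <= 2 / cmod x ^+ 2.
Proof.
have h1 : 1 / 2 <= cmod (1 - hfun x).
  apply: le_trans (Re_1Bhfun x) _; apply: le_trans (Re_le_cmod _); exact: ler_norm.
have := congr1 (@cmod R) (hfunM1B x); rewrite cmodM cmodV cmodX => E.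
have : cmod (hfun x) * (1 / 2) <= (cmod x ^+ 2)^-1.
  by rewrite -E ler_wpM2l ?cmod_ge0.
lra.
Qed.

(** If the real part were 1/2, then h and 1 - h would be conjugate and x^(-2) = 1/4 + b^2 >= 1/4,
    against |x| > 2. *)
Lemma Re_1Bhfun_gt x : 2 < cmod x -> 1 / 2 < complex.Re (1 - hfun x).
Proof.
move=> x2; rewrite lt_def Re_1Bhfun andbT; apply/eqP => e.
have x0 : 0 < cmod x by lra.
have xn0 : x != 0 by rewrite -cmod_gt0.
have lt1 : cmod (4 / x ^+ 2) < 1.
  rewrite cmod_div cmodX cmod_nat ltr_pdivrMr ?exprn_gt0 // mul1r; nra.
have := hfunM1B x.
have : hfun x = 1 - (1 - hfun x) by rewrite subKr.
case: (1 - hfun x) e => a b /= ->; set c := (1 / 2 : R) => ->.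
have -> : (1 - (c +i* b)) * (c +i* b) = (1 / 4 + b ^+ 2)%:C.
  by apply/eqP; rewrite eq_complex /= /c; apply/andP; split; apply/eqP; field.
move=> E; move: lt1; rewrite -E mulrC cmodM cmod_real cmod_nat ger0_norm; nra.
Qed.

(** The difference of the values of h(1 - h) at [f i] and [l] is the difference of the values of h
    times a factor of real part at least s - 1/2 > 0, so h inherits the convergence of x^(-2). *)
Lemma cvg_hfun {T : Type} (F : set_system T) {FF : Filter F} (f : T -> R[i]) (l : R[i]) :
  2 < cmod l -> f @ F --> l -> (fun i => hfun (f i)) @ F --> hfun l.
Proof.
move=> l2 fl.
have l0 : l != 0 by rewrite -cmod_gt0; lra.
have s0 := Re_1Bhfun_gt l2; set s := complex.Re _ in s0.
have inv2 : (fun i => (f i) ^- 2) @ F --> l ^- 2.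
  apply: cvgV; first by rewrite expf_neq0.
  exact: (cvgM fl fl).
move/cvg_cmodP : inv2 => inv2; apply/cvg_cmodP.
apply: (@squeeze_cvgr _ _ _ _ (cst 0)
   (fun i => (s - 1 / 2)^-1 * cmod ((f i) ^- 2 - l ^- 2))).
- apply: nearW => i; rewrite cmod_ge0 /= mulrC ler_pdivlMr; last by lra.
  rewrite -!hfunM1B.
  have -> : hfun (f i) * (1 - hfun (f i)) - hfun l * (1 - hfun l) =
     (hfun (f i) - hfun l) * ((1 - hfun (f i)) + (1 - hfun l) - 1) by ring.
  rewrite cmodM ler_wpM2l ?cmod_ge0 //.
  apply: le_trans (Re_le_cmod _); apply: le_trans (ler_norm _).
  have := Re_1Bhfun (f i); rewrite !ReD ReN /= -/s.
  by move: s0; rewrite /s !ReD /=; lra.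
- exact: cvg_cst.
- have -> : (0 : R) = (s - 1 / 2)^-1 * 0 by rewrite mulr0.
  exact: cvgMr.
Qed.

End Hfun.

(** * Farey edges and Stern-Brocot enumeration *)

Section Farey.
Implicit Types (a b r : rat) (n k : nat).

Definition farey_edge a b : bool := numq b * denq a == numq a * denq b + 1.

Definition mediant a b : rat :=
  (numq a + numq b)%:~R / (denq a + denq b)%:~R.

Lemma ltr_numq_denq a b : (a < b) = (numq a * denq b < numq b * denq a).
Proof. exact: lt_ratE. Qed.

Lemma ler_numq_denq a b : (a <= b) = (numq a * denq b <= numq b * denq a).
Proof. exact: le_ratE. Qed.

(** The determinant condition is a Bezout identity for the sums, so the mediant fraction is already
    reduced. *)
Lemma mediant_spec a b : farey_edge a b ->
  numq (mediant a b) = numq a + numq b /\ denq (mediant a b) = denq a + denq b.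
Proof.
move=> /eqP ab; have da := denq_gt0 a; have db := denq_gt0 b.
have cop : coprime `|numq a + numq b| `|denq a + denq b|.
  apply/coprimezP; exists (denq a, - numq a) => /=.
  by rewrite mulrDr mulNr mulrDr [X in _ + X - _]mulrC ab; ring.
split; rewrite /mediant ?coprimeq_num // ?coprimeq_den //.
  by rewrite gtr0_sg ?mul1r // addr_gt0.
by rewrite gt_eqF ?addr_gt0 // gtr0_norm // addr_gt0.
Qed.

Lemma farey_edge_lt a b : farey_edge a b -> a < b.
Proof. by move=> /eqP ab; rewrite ltr_numq_denq ab ltrDl. Qed.

Lemma farey_edge_mediantl a b : farey_edge a b -> farey_edge a (mediant a b).
Proof.
move=> ab; have [nm dm] := mediant_spec ab.
by rewrite /farey_edge nm dm; apply/eqP; move/eqP: ab; lia.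
Qed.

Lemma farey_edge_mediantr a b : farey_edge a b -> farey_edge (mediant a b) b.
Proof.
move=> ab; have [nm dm] := mediant_spec ab.
by rewrite /farey_edge nm dm; apply/eqP; move/eqP: ab; lia.
Qed.

Lemma farey_edge_neighbors a b : farey_edge a b ->
  farey_neighbors (Some a) (Some b) /\ farey_neighbors (Some b) (Some a).
Proof. by rewrite /farey_edge /farey_neighbors /= => /eqP ->; split; lia. Qed.

Lemma farey_edge_int (z : int) : farey_edge z%:~R (z + 1)%:~R.
Proof. by rewrite /farey_edge !numq_int !denq_int !mulr1. Qed.

Fixpoint stern_brocot k a b : seq rat :=
  if k is k'.+1 then
    stern_brocot k' a (mediant a b) ++
    mediant a b :: stern_brocot k' (mediant a b) b
  else [::].

Lemma stern_brocot_itv k a b r : farey_edge a b ->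
  r \in stern_brocot k a b -> a < r < b.
Proof.
elim: k a b => [//|k IHk] a b ab /=.
have am := farey_edge_mediantl ab; have mb := farey_edge_mediantr ab.
have lam := farey_edge_lt am; have lmb := farey_edge_lt mb.
rewrite mem_cat inE => /or3P[/(IHk _ _ am)/andP[-> h]|/eqP ->|/(IHk _ _ mb)/andP[h ->]].
- by rewrite (lt_trans h).
- by rewrite lam.
- by rewrite (lt_trans lam).
Qed.

Lemma stern_brocot_uniq k a b : farey_edge a b -> uniq (stern_brocot k a b).
Proof.
elim: k a b => [//|k IHk] a b ab /=.
have am := farey_edge_mediantl ab; have mb := farey_edge_mediantr ab.
rewrite cat_uniq /= !IHk // andbT negb_or -andbA /=; apply/and3P; split.
- by apply/negP => /(stern_brocot_itv am); rewrite ltxx andbF.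
- apply/hasPn => r /(stern_brocot_itv mb)/andP[h _].
  by apply/negP => /(stern_brocot_itv am)/andP[_ /(lt_trans h)]; rewrite ltxx.
- by apply/negP => /(stern_brocot_itv mb); rewrite ltxx.
Qed.

(** For r inside ]a, b[, den r = u den b + v den a with integers u, v >= 1, so den r >= den a + den
    b. Each insertion of a mediant raises the sum of the end denominators by at least 1. *)
Lemma stern_brocot_mem k a b r : farey_edge a b -> a < r < b ->
  denq r < denq a + denq b + k%:Z -> r \in stern_brocot k a b.
Proof.
have da := denq_gt0.
elim: k a b => [|k IHk] a b ab.
  rewrite !ltr_numq_denq => /andP[h1 h2] h3; exfalso; move/eqP: ab h3 => ab h3.
  have one : numq b * denq a - numq a * denq b = 1.
    by rewrite ab addrAC subrr add0r.
  have E : (numq r * denq a - numq a * denq r) * denq b +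
           (numq b * denq r - numq r * denq b) * denq a = denq r.
    by rewrite -[RHS]mulr1 -one; ring.
  move: E (da a) (da b) h1 h2 h3; rewrite -2!(subr_gt0 (_ * _)).
  set u := (_ * _ - _); set v := (_ * _ - _); nia.
move=> /andP[ar rb] h /=.
have am := farey_edge_mediantl ab; have mb := farey_edge_mediantr ab.
have [_ dm] := mediant_spec ab.
rewrite mem_cat inE; have [rm|mr|->] := ltgtP r (mediant a b).
- by rewrite IHk ?ar //; move: (da a) (da b) h; rewrite dm; lia.
- by rewrite (IHk (mediant a b)) ?orbT ?mr //; move: (da a) (da b) h; rewrite dm; lia.
- by rewrite orbT.
Qed.

(** Each unit interval contributes its right end and not its left one, to match the half-open ]0,
    n]. *)
Fixpoint stern_brocot_upto k n : seq rat :=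
  if n is n'.+1 then
    stern_brocot_upto k n' ++ rcons (stern_brocot k n'%:R n'.+1%:R) n'.+1%:R
  else [::].

Lemma farey_edge_nat n : farey_edge n%:R n.+1%:R.
Proof. by have := farey_edge_int n; rewrite -PoszD addn1. Qed.

Lemma stern_brocot_upto_itv k n r : r \in stern_brocot_upto k n -> 0 < r <= n%:R.
Proof.
elim: n => [//|n IHn] /=; have en := farey_edge_nat n.
have ltn : (n%:R : rat) < n.+1%:R by rewrite ltr_nat.
rewrite mem_cat mem_rcons inE => /or3P[/IHn/andP[-> h]|/eqP ->|].
- by rewrite (le_trans h) ?ltW.
- by rewrite ltr0n lexx.
- by move=> /(stern_brocot_itv en)/andP[h /ltW ->]; rewrite (le_lt_trans _ h).
Qed.

Lemma stern_brocot_upto_uniq k n : uniq (stern_brocot_upto k n).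
Proof.
elim: n => [//|n IHn] /=; have en := farey_edge_nat n.
have ltn : (n%:R : rat) < n.+1%:R by rewrite ltr_nat.
rewrite cat_uniq IHn rcons_uniq stern_brocot_uniq // andbT /=.
apply/andP; split; last first.
  by apply/negP => /(stern_brocot_itv en); rewrite ltxx andbF.
apply/hasPn => r; rewrite mem_rcons inE => rn.
apply/negP => /stern_brocot_upto_itv/andP[_]; apply/negP; rewrite -ltNge.
by case/orP: rn => [/eqP -> //|/(stern_brocot_itv en)/andP[]].
Qed.

Lemma stern_brocot_upto_mem n r : 0 < r <= n%:R ->
  \forall k \near \oo, r \in stern_brocot_upto k n.
Proof.
elim: n => [/andP[h1 h2]|n IHn /andP[r0]].
  by have := lt_le_trans h1 h2; rewrite ltxx.
have [rn _|nr] := leP r n%:R.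
  have : \forall k \near \oo, r \in stern_brocot_upto k n.
    by apply: IHn; rewrite r0.
  by apply: filterS => k rk /=; rewrite mem_cat rk.
rewrite le_eqVlt => /orP[/eqP ->|rn1].
  by apply: nearW => k /=; rewrite mem_cat mem_rcons mem_head orbT.
exists `|denq r|%N => // k /= rk; rewrite mem_cat mem_rcons inE.
rewrite (stern_brocot_mem (farey_edge_nat n)) ?orbT ?nr //.
have := denq_gt0 (n%:R : rat); have := denq_gt0 (n.+1%:R : rat).
by move: rk; lia.
Qed.

End Farey.

#[local] Existing Instance totally_filter.

(** * Unordered sums over the rationals of ]0, N] *)

Section Summation.
Variable R : realType.

Lemma ler_sum_uniq_sub (I : eqType) (s1 s2 : seq I) (x : I -> R) :
  uniq s1 -> uniq s2 -> {subset s1 <= s2} -> (forall i, 0 <= x i) ->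
  \sum_(i <- s1) x i <= \sum_(i <- s2) x i.
Proof.
move=> u1 u2 s12 x0.
have s1E : perm_eq s1 [seq i <- s2 | i \in s1].
  apply: uniq_perm; rewrite ?filter_uniq // => i; rewrite mem_filter.
  by apply/idP/andP => [i1|[]//]; split=> //; exact: s12.
by rewrite [leRHS](bigID (fun i => i \in s1)) -big_filter -(perm_big _ s1E) lerDl sumr_ge0.
Qed.

Lemma partial_sumE (I : choiceType) (V : zmodType) (x : I -> V) (A : {fset I}) :
  partial_sum x A = \sum_(i <- A) x i.
Proof. by rewrite big_seq_fsetE. Qed.

Lemma partial_sum_cvg_nneg (I : choiceType) (x : I -> R) (M : R) :
  (forall i, 0 <= x i) -> (forall s : seq I, uniq s -> \sum_(i <- s) x i <= M) ->
  exists l : R, partial_sum x @ totally --> l.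
Proof.
move=> x0 xM; pose E := range (partial_sum x).
have hE : has_sup E.
  split; first by exists (partial_sum x fset0); exists fset0.
  by exists M => _ [A _ <-]; rewrite partial_sumE xM ?fset_uniq.
exists (sup E); apply/cvgrPdist_le => e e0.
have [_ [A _ <-] supA] := sup_adherent e0 hE.
exists A => // B /= AB.
have le1 : partial_sum x A <= partial_sum x B.
  by rewrite !partial_sumE ler_sum_uniq_sub ?fset_uniq //; exact/fsubsetP.
have le2 : partial_sum x B <= sup E.
  by apply: sup_upper_bound => //; exists B.
rewrite ger0_norm ?subr_ge0 //; lra.
Qed.

(** Write x as (|x| + x) - |x|, a difference of two nonnegative families with bounded sums. *)
Lemma partial_sum_cvg_real (I : choiceType) (x : I -> R) (M : R) :
  (forall s : seq I, uniq s -> \sum_(i <- s) `|x i| <= M) ->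
  exists l : R, partial_sum x @ totally --> l.
Proof.
move=> xM.
have [l2 c2] := partial_sum_cvg_nneg (fun i => normr_ge0 (x i)) xM.
have [||l1 c1] := @partial_sum_cvg_nneg I (fun i => `|x i| + x i) (2 * M).
- by move=> i; have := ler_norm (- x i); rewrite normrN; lra.
- move=> s us; have := xM s us.
  have : \sum_(i <- s) x i <= \sum_(i <- s) `|x i|.
    by apply: ler_sum => i _; exact: ler_norm.
  rewrite big_split /=; lra.
exists (l1 - l2).
rewrite (_ : partial_sum x = fun A => partial_sum (fun i => `|x i| + x i) A -
    partial_sum (fun i => `|x i|) A); first exact: cvgB.
apply/funext => A.
by rewrite /partial_sum -sumrB; apply: eq_bigr => i _; rewrite addrAC subrr add0r.
Qed.

Lemma Re_sum (I : Type) (s : seq I) (x : I -> R[i]) :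
  complex.Re (\sum_(i <- s) x i) = \sum_(i <- s) complex.Re (x i).
Proof. by apply: (big_morph (@complex.Re R) (@ReD R)). Qed.

Lemma Im_sum (I : Type) (s : seq I) (x : I -> R[i]) :
  complex.Im (\sum_(i <- s) x i) = \sum_(i <- s) complex.Im (x i).
Proof. by apply: (big_morph (@complex.Im R) (@ImD R)). Qed.

Lemma partial_sum_cvg_complex (I : choiceType) (x : I -> R[i]) (M : R) :
  (forall s : seq I, uniq s -> \sum_(i <- s) cmod (x i) <= M) ->
  cvg (partial_sum x @ totally).
Proof.
move=> xM.
have [|a ca] := @partial_sum_cvg_real I (fun i => complex.Re (x i)) M.
  move=> s us; apply: le_trans (xM s us); apply: ler_sum => i _; exact: Re_le_cmod.
have [|b cb] := @partial_sum_cvg_real I (fun i => complex.Im (x i)) M.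
  move=> s us; apply: le_trans (xM s us); apply: ler_sum => i _; exact: Im_le_cmod.
apply/cvg_ex; exists (a +i* b); apply/cvg_cmodP.
apply: (@squeeze_cvgr _ _ _ _ (cst 0)
  (fun A => `|partial_sum (fun i => complex.Re (x i)) A - a| +
     `|partial_sum (fun i => complex.Im (x i)) A - b|)).
- apply: nearW => A; rewrite cmod_ge0 /=; apply: le_trans (cmod_le_ReIm _) _.
  by rewrite ReD ImD ReN ImN /= !partial_sumE Re_sum Im_sum.
- exact: cvg_cst.
- have -> : (0 : R) = `|a - a| + `|b - b| by rewrite !subrr normr0 addr0.
  by apply: cvgD; apply: cvg_norm; apply: cvgB => //; exact: cvg_cst.
Qed.

(** A telescoping majorant of 1/i^2. Its term at 0 is 0, as division by 0 gives 0. *)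
Let u (i : nat) : R := 2 / (i%:R * i.+1%:R).

Let u_ge0 i : 0 <= u i.
Proof. by rewrite divr_ge0 ?mulr_ge0. Qed.

Let sum_u n : \sum_(0 <= i < n) u i <= 2.
Proof.
suff E : \sum_(0 <= i < n.+1) u i = 2 - 2 / n.+1%:R.
  apply: (@le_trans _ _ (\sum_(0 <= i < n.+1) u i)).
    by rewrite big_nat_recr //= lerDl.
  by rewrite E gerBl divr_ge0.
elim: n => [|n IHn]; first by rewrite big_nat1 /u mul0r invr0 mulr0 divr1 subrr.
rewrite big_nat_recr // IHn /u.
have n1 : (0 : R) < n.+1%:R by rewrite ltr0n.
have -> : n.+2%:R = n.+1%:R + 1 :> R by rewrite -natr1.
rewrite /=; field; apply/andP; split; apply: lt0r_neq0; lra.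
Qed.

Let inv_sqr_le_u n : (0 < n)%N -> (n%:R ^+ 2)^-1 <= u n.
Proof.
move=> n0; have n1 : (1 : R) <= n%:R by rewrite ler1n.
rewrite /u -natr1; set m : R := n%:R in n1 *.
have m0 : 0 < m ^+ 2 by rewrite exprn_gt0 //; lra.
have m2 : 0 < m * (m + 1) by rewrite mulr_gt0 //; lra.
rewrite -[leLHS]mul1r ler_pdivrMr // mulrAC ler_pdivlMr //; nra.
Qed.

(** For r = n/d <= N one has n <= N d, so 1/d^4 <= N^2/(n^2 d^2), and the sum over reduced fractions
    is dominated by a product of two series, each at most 2. *)
Lemma sum_inv_den4_le (N : nat) (s : seq rat) : uniq s ->
  {in s, forall r, 0 < r <= N%:R} ->
  \sum_(r <- s) ((denq r)%:~R ^+ 4 : R)^-1 <= 4 * N%:R ^+ 2.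
Proof.
move=> us sN.
pose f r := (`|numq r|%N, `|denq r|%N).
pose M := (\sum_(r <- s) (`|numq r| + `|denq r|)).+1.
have fM r : r \in s -> ((f r).1 < M)%N /\ ((f r).2 < M)%N.
  move=> rs; rewrite /M (big_rem r rs) /=; split; rewrite ltnS; lia.
apply: (@le_trans _ _ (\sum_(z <- map f s) N%:R ^+ 2 * (u z.1 * u z.2))).
  rewrite big_map big_seq [leRHS]big_seq; apply: ler_sum => r rs.
  have /andP[r0 rN] := sN r rs.
  have n0 : (0 < `|numq r|)%N by rewrite absz_gt0 numq_eq0 gt_eqF.
  have d0 : (0 < `|denq r|)%N by rewrite absz_gt0 denq_eq0.
  have En : (denq r)%:~R = `|denq r|%:R :> R by rewrite -{1}absz_denq.
  have nNd : (`|numq r|%:R : R) <= N%:R * `|denq r|%:R.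
    rewrite -natrM ler_nat.
    have : numq r <= N%:Z * denq r.
      have := rN; rewrite ler_numq_denq -[N%:R]/(N%:~R) numq_int denq_int mulr1.
      by [].
    have := denq_gt0 r; have : 0 < numq r by rewrite numq_gt0.
    by lia.
  have h1 := inv_sqr_le_u n0; have h2 := inv_sqr_le_u d0.
  rewrite En; set n := `|numq r|%:R in nNd h1 *; set d := `|denq r|%:R in nNd h1 h2 *.
  have n1 : 1 <= n :> R by rewrite ler1n.
  have d1 : 1 <= d :> R by rewrite ler1n.
  apply: (@le_trans _ _ (N%:R ^+ 2 * ((n ^+ 2)^-1 * (d ^+ 2)^-1))).
    have dp : 0 < d by lra.
    have np : 0 < n by lra.
    have -> : N%:R ^+ 2 * ((n ^+ 2)^-1 * (d ^+ 2)^-1) =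
        (N%:R * d) ^+ 2 / n ^+ 2 * (d ^+ 4)^-1 by field; rewrite !lt0r_neq0.
    rewrite -[leLHS]mul1r ler_wpM2r ?invr_ge0 ?exprn_ge0 ?(ltW dp) //.
    rewrite ler_pdivlMr ?exprn_gt0 // mul1r ler_pXn2r // nnegrE ?(ltW np) // ltW //.
    exact: lt_le_trans nNd.
  by rewrite ler_wpM2l ?exprn_ge0 // ler_pM ?invr_ge0 ?exprn_ge0 //; lra.
have uf : uniq (map f s).
  rewrite map_inj_in_uniq // => r r' rs rs' [].
  have /andP[/ltW r0 _] := sN r rs; have /andP[/ltW r'0 _] := sN r' rs'.
  move=> /(congr1 Posz) + /(congr1 Posz).
  rewrite !absz_denq !gez0_abs ?numq_ge0 // => E1 E2.
  by rewrite -(divq_num_den r) E1 E2 divq_num_den.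
apply: (@le_trans _ _ (\sum_(z <- [seq (i, j) | i <- iota 0 M, j <- iota 0 M])
    N%:R ^+ 2 * (u z.1 * u z.2))).
  apply: ler_sum_uniq_sub => //.
  - by apply: allpairs_uniq; rewrite ?iota_uniq // => -[? ?] [? ?].
  - move=> _ /mapP[r rs ->]; have [h1 h2] := fM r rs.
    by apply/allpairsP; exists (f r); rewrite !mem_iota !add0n h1 h2.
  - by move=> [i j]; rewrite mulr_ge0 ?exprn_ge0 ?mulr_ge0.
rewrite -mulr_sumr mulrC ler_wpM2r ?exprn_ge0 //.
rewrite big_allpairs /=.
under eq_bigr do rewrite -mulr_sumr.
rewrite -mulr_suml; have := sum_u M; rewrite /index_iota subn0.
have : 0 <= \sum_(i <- iota 0 M) u i by apply: sumr_ge0.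
nra.
Qed.

Variables (F : rat -> R[i]) (N : nat) (K : R).
Hypothesis F_le : forall r : rat, 0 < r <= N%:R -> cmod (F r) <= K / (denq r)%:~R ^+ 4.

Lemma rat_partial_sum_cvg : cvg (rat_partial_sum F N @ totally).
Proof.
apply: (@partial_sum_cvg_complex _ _ (`|K| * (4 * N%:R ^+ 2))) => s us.
apply: (@le_trans _ _ (\sum_(i <- map val s) `|K| * ((denq i)%:~R ^+ 4)^-1)).
  rewrite big_map; apply: ler_sum => -[r rN] _ /=.
  apply: le_trans (F_le rN) _; apply: ler_wpM2r; last exact: ler_norm.
  by rewrite invr_ge0 exprn_ge0 // ler0z ltW.
rewrite -mulr_sumr ler_wpM2l // sum_inv_den4_le //.
  by rewrite map_inj_uniq //; exact: val_inj.
by move=> _ /mapP[[r rN] _ ->].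
Qed.

(** A finite set of indices is eventually contained in [s k], so the unordered sum may be computed
    along any exhaustion, in particular along Stern-Brocot levels. *)
Lemma rat_sum_cvg (s : nat -> seq rat) : (forall k, uniq (s k)) ->
  (forall k r, r \in s k -> 0 < r <= N%:R) ->
  (forall r : rat, 0 < r <= N%:R -> \forall k \near \oo, r \in s k) ->
  (fun k => \sum_(r <- s k) F r) @ \oo --> rat_sum F N.
Proof.
move=> us sN sall.
pose T := {r : rat | 0 < r <= N%:R}.
pose A k : {fset T} := [fset x in pmap insub (s k)]%fset.
have AE k : rat_partial_sum F N (A k) = \sum_(r <- s k) F r.
  rewrite /rat_partial_sum partial_sumE.
  have -> : \sum_(i <- A k) F (val i) = \sum_(i <- map val (A k)) F i by rewrite big_map.
  apply: perm_big; apply: uniq_perm => //.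
    by rewrite map_inj_uniq ?fset_uniq //; exact: val_inj.
  move=> r; apply/mapP/idP => [[x]|rs].
    by rewrite !inE /= mem_pmap => /mapP[r' rs']; case: insubP => // y _ yr' [->] ->; rewrite yr'.
  exists (Sub r (sN k r rs)) => //.
  rewrite !inE /= mem_pmap; apply/mapP; exists r => //.
  by rewrite (insubT (fun r => 0 < r <= N%:R) (sN k r rs)).
rewrite (_ : (fun k => _) = rat_partial_sum F N \o A); last by apply/funext => k /=.
apply: cvg_comp rat_partial_sum_cvg.
move=> P [B _ BP].
suff : \forall k \near \oo, (B `<=` A k)%fset by apply: filterS => k; exact: BP.
have h (x : T) : \forall k \near \oo, x \in A k.
  apply: filterS (sall _ (valP x)) => k xs.
  rewrite !inE /= mem_pmap; apply/mapP; exists (val x) => //.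
  by rewrite valK.
have : \forall k \near \oo, forall x, x \in enum_fset B -> x \in A k.
  elim: (enum_fset B) => [|x e IHe]; first by apply: nearW.
  apply: filterS2 (h x) IHe => k xk ek y; rewrite inE => /orP[/eqP -> //|]; exact: ek.
by apply: filterS => k hk; apply/fsubsetP.
Qed.

End Summation.

(** * The infinite product beyond a Farey edge, for abstract G, p, D, H *)

Section EdgeProduct.
Variables (R : realType) (psi : rat -> R[i]) (G : R[i] -> R[i] -> R[i] -> R[i]).
Variables (p D H : R[i] -> R[i]) (adm : rat -> rat -> R[i] -> Prop) (K : R).
Local Notation den a := ((denq a)%:~R : R).

Hypothesis adm_edge : forall a b w, adm a b w -> farey_edge a b.
Hypothesis adm_left : forall a b w, adm a b w -> adm a (mediant a b) (psi b).
Hypothesis adm_right : forall a b w, adm a b w -> adm (mediant a b) b (psi a).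
Hypothesis G_vertex : forall a b w, adm a b w ->
  G (psi a) (psi b) w * D (psi (mediant a b)) =
  G (psi a) (psi (mediant a b)) (psi b) * G (psi (mediant a b)) (psi b) (psi a).
Hypothesis p_neq0 : forall a b w, adm a b w -> p (psi a) != 0 /\ p (psi b) != 0.
Hypothesis HD : forall a b w, adm a b w ->
  D (psi (mediant a b)) != 0 /\
  H (psi (mediant a b)) = p (psi (mediant a b)) ^+ 2 / D (psi (mediant a b)).
Hypothesis G_near : forall a b w, adm a b w ->
  cmod (G (psi a) (psi b) w / (p (psi a) * p (psi b)) - 1) <=
    K / (Num.max (den a) (den b) * (den a * den b)).

(** The product, over the 2^k edges present after k rounds of mediants, of the ratio of G to the
    product of p at the two ends. The last argument follows the vertex behind the current edge. *)
Fixpoint frontier_prod k a b w : R[i] :=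
  if k is k'.+1 then
    frontier_prod k' a (mediant a b) (psi b) * frontier_prod k' (mediant a b) b (psi a)
  else G (psi a) (psi b) w / (p (psi a) * p (psi b)).

(** At each new mediant m, [G_vertex] divides by D(m), and m is an end of both new edges, giving
    p(m)^2; together this is H(m). *)
Lemma frontier_prodE k a b w : adm a b w ->
  G (psi a) (psi b) w =
  p (psi a) * p (psi b) * (\prod_(r <- stern_brocot k a b) H (psi r)) *
  frontier_prod k a b w.
Proof.
elim: k a b w => [|k IHk] a b w ab.
  have [pa pb] := p_neq0 ab.
  by rewrite big_nil mulr1 /= mulrC divfK // mulf_neq0.
have [Dm Hm] := HD ab; have [_ pm] := p_neq0 (adm_left ab).
apply: (mulIf Dm); rewrite G_vertex // (IHk _ _ _ (adm_left ab)) (IHk _ _ _ (adm_right ab)).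
rewrite /= big_cat big_cons Hm /=.
set P1 := \prod_(i <- _) _; set P2 := \prod_(i <- _) _; by field.
Qed.

Lemma den_ge1 a : 1 <= den a.
Proof. by rewrite -[1]/(1%:~R) ler_int -gtz0_ge1 denq_gt0. Qed.

(** The quantity 1 + |u - 1| is submultiplicative, so exponential bounds on the factors add up in
    the exponent. *)
Lemma cmod_prodB1_le (u v : R[i]) (x y : R) :
  1 + cmod (u - 1) <= x -> 1 + cmod (v - 1) <= y -> 1 + cmod (u * v - 1) <= x * y.
Proof.
move=> ux vy; have u0 := cmod_ge0 (u - 1); have v0 := cmod_ge0 (v - 1).
have -> : u * v - 1 = (u - 1) * (v - 1) + ((u - 1) + (v - 1)) by ring.
have h1 := le_cmodD ((u - 1) * (v - 1)) ((u - 1) + (v - 1)).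
have h2 := le_cmodD (u - 1) (v - 1).
rewrite cmodM in h1; nra.
Qed.

(* The weight 1/(den a * den b), which is b - a, is additive under insertion of
   mediants, so the errors of all the edges at depth [k] add up to at most
   K/(j + k) times the weight of the initial edge. *)
Lemma frontier_prod_near1 k j a b w : 0 <= K -> adm a b w ->
  (0 < j)%N -> j%:R <= Num.max (den a) (den b) ->
  1 + cmod (frontier_prod k a b w - 1) <=
    expR (K / ((j + k)%:R * (den a * den b))).
Proof.
move=> K0; elim: k j a b w => [|k IHk] j a b w ab j0 jm.
  rewrite addn0 /=; apply: le_trans (expR_ge1Dx _); rewrite lerD2l.
  apply: le_trans (G_near ab) _.
  have da := den_ge1 a; have db := den_ge1 b.
  apply: ler_wpM2l => //.
  have j0R : (0 : R) < j%:R by rewrite ltr0n.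
  rewrite lef_pV2 ?posrE ?ler_pM2r ?mulr_gt0 //; lra.
have e := adm_edge ab; have [_ dm] := mediant_spec e.
have da := den_ge1 a; have db := den_ge1 b.
have dmR : den (mediant a b) = den a + den b by rewrite dm intrD.
have j1 : j.+1%:R <= den (mediant a b).
  by rewrite dmR -natr1; move: jm; rewrite le_max => /orP[] h; lra.
have h1 := IHk j.+1 a _ _ (adm_left ab) isT.
have h2 := IHk j.+1 _ b _ (adm_right ab) isT.
apply: (le_trans (cmod_prodB1_le (h1 _) (h2 _))); rewrite ?le_max ?j1 ?orbT //.
rewrite -expRD ler_expR dmR addSnnS.
have jk : (0 : R) < (j + k.+1)%:R by rewrite ltr0n addnS.
rewrite le_eqVlt; apply/orP; left; apply/eqP; field.
rewrite !lt0r_neq0 //; lra.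
Qed.

(** Divide [frontier_prodE] by the frontier product, which tends to 1 and so is eventually
    nonzero. *)
Lemma stern_brocot_prod_cvg a b w : 0 <= K -> adm a b w ->
  (fun k => \prod_(r <- stern_brocot k a b) H (psi r)) @ \oo -->
  G (psi a) (psi b) w / (p (psi a) * p (psi b)).
Proof.
move=> K0 ab; have [pa pb] := p_neq0 ab.
have f1 : (fun k => frontier_prod k a b w) @ \oo --> (1 : R[i]).
  apply/cvg_cmodP.
  apply: (@squeeze_cvgr _ _ _ _ (cst 0)
     (fun k => expR (K / (den a * den b) * k.+1%:R^-1) - 1)).
  - apply: nearW => k; rewrite cmod_ge0 /= lerBrDl.
    apply: (le_trans (frontier_prod_near1 k K0 ab (ltn0Sn 0) _)).
      by rewrite le_max den_ge1.
    by rewrite ler_expR invfM mulrA mulrAC.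
  - exact: cvg_cst.
  - have -> : (0 : R) = expR (K / (den a * den b) * 0) - 1.
      by rewrite mulr0 expR0 subrr.
    apply: cvgB; last exact: cvg_cst.
    apply: continuous_cvg; first exact: continuous_expR.
    by apply: cvgMr; exact: cvg_harmonic.
set g := G _ _ _ / _.
have g1 : (fun k => g * (frontier_prod k a b w)^-1) @ \oo --> g.
  have {2}-> : g = g * 1^-1 by rewrite invr1 mulr1.
  by apply: cvgMr; apply: cvgV => //; exact: oner_neq0.
apply: cvg_trans g1; apply: near_eq_cvg.
have : \forall k \near \oo, frontier_prod k a b w != 0.
  move/cvgrPdist_lt : f1 => /(_ 1 ltr01); apply: filterS => k.
  by apply: contraTneq => ->; rewrite subr0 normr1 ltxx.
apply: filterS => k fk; rewrite /g (frontier_prodE k ab).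
by set P := \prod_(i <- _) _; field; rewrite fk pa pb.
Qed.

Variables (N : nat) (x : R[i]) (F : rat -> R[i]) (B : R).
Hypothesis K_ge0 : 0 <= K.
Hypothesis adm_root : forall n, (n < N)%N -> adm n%:R n.+1%:R x.
Hypothesis F_le : forall r : rat, 0 < r <= N%:R -> cmod (F r) <= B / (denq r)%:~R ^+ 4.
Hypothesis cexpF : forall r : rat, 0 < r <= N%:R -> cexp (F r) = H (psi r).

(** By continuity the exponential of the sum is the limit of finite products, which split over the
    unit intervals; the last factor H belongs to the integer right end. *)
Lemma cexp_rat_sum : cexp (rat_sum F N) =
  \prod_(0 <= n < N) (G (psi n%:R) (psi n.+1%:R) x /
     (p (psi n%:R) * p (psi n.+1%:R)) * H (psi n.+1%:R)).
Proof.
have c1 : (fun k => cexp (\sum_(r <- stern_brocot_upto k N) F r)) @ \oo -->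
    cexp (rat_sum F N).
  apply: cvg_cexp; apply: rat_sum_cvg F_le _ _ _ _ => [k|k r|r].
  - exact: stern_brocot_upto_uniq.
  - exact: stern_brocot_upto_itv.
  - exact: stern_brocot_upto_mem.
have haus : hausdorff_space R[i] by exact: norm_hausdorff.
apply: (cvg_unique haus c1).
rewrite (_ : (fun k => _) = fun k => \prod_(r <- stern_brocot_upto k N) H (psi r)); last first.
  apply/funext => k; rewrite cexp_sum big_seq [RHS]big_seq; apply: eq_bigr => r rk.
  by rewrite cexpF // (stern_brocot_upto_itv rk).
suff h n : (n <= N)%N ->
    (fun k => \prod_(r <- stern_brocot_upto k n) H (psi r)) @ \oo -->
    \prod_(0 <= n < n) (G (psi n%:R) (psi n.+1%:R) x /
     (p (psi n%:R) * p (psi n.+1%:R)) * H (psi n.+1%:R)) by exact: h.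
elim: n => [_|n IHn nN].
  under eq_fun do rewrite big_nil; rewrite big_nil; exact: cvg_cst.
under eq_fun do rewrite big_cat /= big_rcons /=.
rewrite (big_nat_recr _ _ _ (leq0n n)).
apply: cvgM; first exact: (IHn (ltnW nN)).
apply: cvgM; last exact: cvg_cst.
exact: (stern_brocot_prod_cvg K_ge0 (adm_root nN)).
Qed.

End EdgeProduct.

(** * Growth of values and estimates on one edge *)

Section Growth.
Variable R : realType.
Implicit Types (a b c w mu : R[i]) (m : R).

(** Since both moduli exceed 2, |w| <= max(|a|, |b|) <= |ab|/2, hence |ab - w| >= |ab|/2 >= max(|a|,
    |b|): growth persists away from the root. *)
Lemma cmod_child_ge m a b w : 2 < m -> m <= cmod a -> m <= cmod b ->
  cmod w <= Num.max (cmod a) (cmod b) ->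
  [/\ cmod a <= cmod (a * b - w), cmod b <= cmod (a * b - w) &
      cmod a * cmod b / 2 <= cmod (a * b - w)].
Proof.
move=> m2 ma mb wab.
have h : cmod a * cmod b - cmod w <= cmod (a * b - w) by rewrite -cmodM ge_cmodB.
move: h ma mb wab; rewrite le_max.
set c := cmod _; set al := cmod a; set be := cmod b; set om := cmod w.
by move=> h ma mb /orP[] wl; split; nra.
Qed.

(** With c = ab - w the vertex relation gives c^2 - mu = ab c - (a^2 + b^2), where the first term
    dominates. This keeps D, hence p, away from 0 at every new vertex. *)
Lemma cmod_child_sqrB_ge mu m a b w : 2 < m -> m <= cmod a -> m <= cmod b ->
  cmod w <= Num.max (cmod a) (cmod b) ->
  w ^+ 2 + a ^+ 2 + b ^+ 2 - w * a * b = mu ->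
  m ^+ 2 * (m - 2) <= cmod ((a * b - w) ^+ 2 - mu).
Proof.
move=> m2 ma mb wab vert.
have -> : (a * b - w) ^+ 2 - mu = a * b * (a * b - w) - (a ^+ 2 + b ^+ 2).
  by rewrite -vert; ring.
have h1 := ge_cmodB (a * b * (a * b - w)) (a ^+ 2 + b ^+ 2).
have h2 := le_cmodD (a ^+ 2) (b ^+ 2).
have h3 : cmod a * cmod b - cmod w <= cmod (a * b - w) by rewrite -cmodM ge_cmodB.
rewrite !cmodM in h1; rewrite !cmodX in h2.
have w0 := cmod_ge0 w.
move: h1 h2 h3 ma mb wab w0; rewrite le_max.
set c := cmod (a * b - w); set s := cmod (a ^+ 2 + b ^+ 2).
set al := cmod a; set be := cmod b; set om := cmod w.
move=> h1 h2 h3 ma mb wab w0; apply: le_trans h1.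
(* For x <= y: xy(xy - y) - x^2 - y^2 >= y^2 (x - 2)(x + 1), and x + 1 >= 1. *)
have key x y : m <= x -> x <= y -> x * y - y <= c ->
    m ^+ 2 * (m - 2) <= x * y * c - (x ^+ 2 + y ^+ 2).
  move=> mx xy yc.
  have e1 : x * y * (x * y - y) <= x * y * c by rewrite ler_wpM2l //; nra.
  have e2 : y ^+ 2 * ((x - 2) * (x + 1)) <= x * y * (x * y - y) - (x ^+ 2 + y ^+ 2).
    nra.
  have e3 : m ^+ 2 * (m - 2) <= y ^+ 2 * ((x - 2) * (x + 1)).
    apply: ler_pM; nra.
  lra.
have [ab|ba] := leP al be.
  have : m ^+ 2 * (m - 2) <= al * be * c - (al ^+ 2 + be ^+ 2).
    by apply: key => //; case/orP: wab; lra.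
  lra.
have : m ^+ 2 * (m - 2) <= be * al * c - (be ^+ 2 + al ^+ 2).
  by apply: key => //; [lra | case/orP: wab; nra].
rewrite (mulrC be); lra.
Qed.

(** For c = w/(ab) the vertex relation reads c(1 - c) = a^(-2) + (1 - mu/a^2)/b^2, a perturbation of
    the equation of h(a). The cofactor 1 - h - c of c - h has modulus at least 1/2 - 1/m, because
    |c| <= 1/|a|; this selects the right root. *)
Lemma hfun_near_edge mu m a b w : 2 < m -> m <= cmod a -> cmod a <= cmod b ->
  cmod w <= cmod b -> w ^+ 2 + a ^+ 2 + b ^+ 2 - w * a * b = mu ->
  cmod (w / (a * b) - hfun a) <=
    (1 + cmod mu / 4) / (1 / 2 - 1 / m) / cmod b ^+ 2.
Proof.
move=> m2 ma ab wb vert.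
have a0 : 0 < cmod a by lra.
have b0 : 0 < cmod b by lra.
have an0 : a != 0 by rewrite -cmod_gt0.
have bn0 : b != 0 by rewrite -cmod_gt0.
set c := w / (a * b); set h := hfun a.
have im : (cmod a)^-1 <= m^-1 by rewrite lef_pV2 // posrE; lra.
have m20 : 0 < 1 / 2 - 1 / m.
  by rewrite subr_gt0 mul1r mul1r ltf_pV2 // posrE; lra.
have E : (c - h) * (1 - h - c) = (1 - mu / a ^+ 2) / b ^+ 2.
  have -> : (c - h) * (1 - h - c) = c * (1 - c) - h * (1 - h) by ring.
  by rewrite hfunM1B -vert /c; field; rewrite an0 bn0.
have c_le : cmod c <= 1 / m.
  rewrite cmod_div cmodM; apply: (@le_trans _ _ (cmod a)^-1); last by rewrite mul1r.
  by rewrite ler_pdivrMr ?mulr_gt0 // mulKf // gt_eqF.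
have den : 1 / 2 - 1 / m <= cmod (1 - h - c).
  have := Re_1Bhfun a; rewrite -/h => r1.
  have := le_trans r1 (le_trans (ler_norm _) (Re_le_cmod _)).
  have := ge_cmodB (1 - h) c; lra.
have num : cmod (1 - mu / a ^+ 2) <= 1 + cmod mu / 4.
  apply: le_trans (le_cmodB _ _) _; rewrite cmod1 lerD2l cmod_div cmodX.
  by rewrite ler_wpM2l ?cmod_ge0 // lef_pV2 ?posrE ?exprn_gt0 //; nra.
rewrite mulrAC ler_pdivlMr // ; apply: (@le_trans _ _ (cmod ((c - h) * (1 - h - c)))).
  by rewrite cmodM ler_wpM2l ?cmod_ge0.
rewrite E cmod_div cmodX; apply: ler_wpM2r => //.
by rewrite invr_ge0 exprn_ge0 ?cmod_ge0.
Qed.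

(** The summand 2 pays for h at the end of larger modulus, by [cmod_hfun_le]. *)
Definition edge_const mu m : R := (1 + cmod mu / 4) / (1 / 2 - 1 / m) + 2.

Lemma hfun2_near_edge mu m a b w : 2 < m -> m <= cmod a -> m <= cmod b ->
  cmod w <= Num.max (cmod a) (cmod b) ->
  w ^+ 2 + a ^+ 2 + b ^+ 2 - w * a * b = mu ->
  cmod (w / (a * b) - (hfun a + hfun b)) <=
    edge_const mu m / Num.max (cmod a) (cmod b) ^+ 2.
Proof.
move=> m2.
have key x y z : m <= cmod x -> cmod x <= cmod y -> cmod z <= cmod y ->
    z ^+ 2 + x ^+ 2 + y ^+ 2 - z * x * y = mu ->
    cmod (z / (x * y) - (hfun x + hfun y)) <= edge_const mu m / cmod y ^+ 2.
  move=> mx xy zy vert.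
  rewrite opprD addrA; apply: le_trans (le_cmodB _ _) _.
  rewrite /edge_const mulrDl lerD ?cmod_hfun_le //.
  exact: hfun_near_edge.
move=> ma mb wab vert; have [ab|ba] := leP (cmod a) (cmod b).
  by apply: key => //; move: wab; rewrite le_max => /orP[] ?; lra.
rewrite [a * b]mulrC [hfun a + _]addrC; apply: key => //; first exact: ltW.
  by move: wab; rewrite le_max => /orP[] ?; lra.
by rewrite -vert; ring.
Qed.

(** Bernoulli's inequality for sqrt(rho) = 1 + e, then squared. *)
Lemma exp_ge_sqr (rho : R) : 1 < rho ->
  exists2 c : R, 0 < c & forall d : nat, c * d%:R ^+ 2 <= rho ^+ d.
Proof.
move=> rho1.
have [e e0 s2] : exists2 e : R, 0 < e & (1 + e) ^+ 2 = rho.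
  exists (Num.sqrt rho - 1); first by rewrite subr_gt0 -[ltLHS]sqrtr1 ltr_sqrt //; lra.
  by rewrite addrC subrK sqr_sqrtr //; lra.
exists (e ^+ 2) => [|d]; first by rewrite exprn_gt0.
rewrite -s2 -exprM mulnC exprM -exprMn.
have bern n : 1 + n%:R * e <= (1 + e) ^+ n.
  elim: n => [|n IHn]; first by rewrite mul0r addr0.
  rewrite exprS -natr1; have n0 : (0 : R) <= n%:R by [].
  have h : (1 + e) * (1 + n%:R * e) <= (1 + e) * (1 + e) ^+ n.
    by apply: ler_wpM2l => //; lra.
  nra.
have d0 : (0 : R) <= d%:R by []; have := bern d.
by move=> h; apply: lerXn2r; rewrite ?nnegrE; nra.
Qed.

End Growth.

(** * Propagation of growth through the tree *)

Section Admissible.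
Variables (R : realType) (psi : rat -> R[i]) (mu : R[i]) (rho delta : R).
Hypothesis rho_gt1 : 1 < rho.
Hypothesis delta_le : delta <= (2 * rho) ^+ 2 * (2 * rho - 2).
Hypothesis tree_left : forall a b, farey_edge a b ->
  psi a * psi (mediant a b) = psi b + psi (mediant a (mediant a b)).
Hypothesis tree_right : forall a b, farey_edge a b ->
  psi (mediant a b) * psi b = psi a + psi (mediant (mediant a b) b).
Local Notation den a := `|denq a|%N.

(** The factor 2 makes the first clause hereditary: a child has at least half the product of its
    parents' moduli, and denominators add. The second is inherited by [delta_le] and
    [cmod_child_sqrB_ge]. *)
Definition large (a : rat) : Prop :=
  2 * rho ^+ den a <= cmod (psi a) /\ delta <= cmod (psi a ^+ 2 - mu).

(* [w] is the value at the third vertex of the Farey triangle lying on the side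
   of the edge [a, b] opposite to [mediant a b]. *)
Record admissible a b w : Prop := Admissible {
  admissible_edge : farey_edge a b;
  admissible_old : cmod w <= Num.max (cmod (psi a)) (cmod (psi b));
  admissible_l : large a;
  admissible_r : large b;
  admissible_next : psi a * psi b = w + psi (mediant a b);
  admissible_vertex :
    w ^+ 2 + psi a ^+ 2 + psi b ^+ 2 - w * psi a * psi b = mu }.

Lemma den_gt0 a : (0 < den a)%N.
Proof. by rewrite absz_gt0 denq_neq0. Qed.

Lemma rho_exp_ge a : rho <= rho ^+ den a.
Proof. by rewrite -[leLHS]expr1 ler_weXn2l ?den_gt0 // ltW. Qed.

Lemma large_cmod_ge a : large a -> 2 * rho <= cmod (psi a).
Proof. by case=> h _; have := rho_exp_ge a; lra. Qed.

Lemma admissible_mediant a b w : admissible a b w ->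
  [/\ cmod (psi a) <= cmod (psi (mediant a b)),
      cmod (psi b) <= cmod (psi (mediant a b)) & large (mediant a b)].
Proof.
case=> ab old la lb next vert.
have m2 : 2 < 2 * rho by have := rho_gt1; lra.
have ma := large_cmod_ge la; have mb := large_cmod_ge lb.
have E : psi (mediant a b) = psi a * psi b - w by rewrite next addrAC subrr add0r.
have [h1 h2 h3] := cmod_child_ge m2 ma mb old.
split; rewrite ?E //; split; rewrite E; last first.
  exact: le_trans delta_le (cmod_child_sqrB_ge m2 ma mb old vert).
apply: le_trans h3; have [_ dm] := mediant_spec ab.
have -> : den (mediant a b) = (den a + den b)%N.
  by have := denq_gt0 a; have := denq_gt0 b; rewrite dm; lia.
rewrite exprD; case: la lb => la _ [lb _].
have rho0 : 0 <= rho by have := rho_gt1; lra.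
have ra : 0 <= rho ^+ den a by rewrite exprn_ge0.
have rb : 0 <= rho ^+ den b by rewrite exprn_ge0.
have : (2 * rho ^+ den a) * (2 * rho ^+ den b) <= cmod (psi a) * cmod (psi b).
  by apply: ler_pM; rewrite ?mulr_ge0.
lra.
Qed.

Lemma admissible_left a b w : admissible a b w -> admissible a (mediant a b) (psi b).
Proof.
move=> adm; have [h1 h2 lm] := admissible_mediant adm.
case: adm => ab old la lb next vert; split => //.
- exact: farey_edge_mediantl.
- by rewrite le_max h2 orbT.
- exact: tree_left.
- have E : psi (mediant a b) = psi a * psi b - w by rewrite next addrAC subrr add0r.
  by rewrite E -vert; ring.
Qed.

Lemma admissible_right a b w : admissible a b w -> admissible (mediant a b) b (psi a).
Proof.
move=> adm; have [h1 h2 lm] := admissible_mediant adm.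
case: adm => ab old la lb next vert; split => //.
- exact: farey_edge_mediantr.
- by rewrite le_max h1.
- exact: tree_right.
- have E : psi (mediant a b) = psi a * psi b - w by rewrite next addrAC subrr add0r.
  by rewrite E -vert; ring.
Qed.

Lemma stern_brocot_large k a b w r : admissible a b w ->
  r \in stern_brocot k a b -> large r.
Proof.
elim: k a b w => [//|k IHk] a b w adm /=.
rewrite mem_cat inE => /or3P[||].
- exact: IHk (admissible_left adm).
- by move/eqP->; case: (admissible_mediant adm).
- exact: IHk (admissible_right adm).
Qed.

(** Exponential growth is traded for a power of the denominator that suffices both for summability
    and for the weights in [G_near]. *)
Lemma large_inv_sqr_le : exists2 K : R, 0 <= K &
  forall a, large a -> (cmod (psi a) ^+ 2)^-1 <= K / (denq a)%:~R ^+ 4.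
Proof.
have [c c0 hc] := exp_ge_sqr rho_gt1.
exists (c ^+ 2)^-1 => [|a [la _]]; first by rewrite invr_ge0 exprn_ge0 // ltW.
have En : (denq a)%:~R = (den a)%:R :> R by rewrite -{1}absz_denq.
have d0 : (0 : R) < (den a)%:R by rewrite ltr0n den_gt0.
have p0 : 0 < cmod (psi a) by have := rho_exp_ge a; have := rho_gt1; lra.
rewrite En -invfM lef_pV2 ?posrE ?mulr_gt0 ?exprn_gt0 //.
have -> : c ^+ 2 * (den a)%:R ^+ 4 = (c * (den a)%:R ^+ 2) ^+ 2 by rewrite exprMn -exprM.
have := hc (den a); have : 0 <= c * (den a)%:R ^+ 2 by rewrite mulr_ge0 ?exprn_ge0 // ltW.
move=> h1 h2; apply: lerXn2r; rewrite ?nnegrE ?cmod_ge0 //.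
apply: le_trans la; nra.
Qed.

End Admissible.

(** * The functions p and G for mu nonzero *)

Section HyperbolicGap.
Variable R : realType.
Implicit Types (a b m w z mu t : R[i]).

Definition pfun t z : R[i] := 1 + (t - 1) * hfun z.

Definition Gfun t a b w : R[i] := 1 + (t - 1) * (w / (a * b)).

Variables (mu t : R[i]) (delta : R).
Hypothesis t_neq0 : t != 0.
Hypothesis t_mu : t + t^-1 = 2 - mu.
Hypothesis delta_gt0 : 0 < delta.

Let sqr_t_B1 : (t - 1) ^+ 2 = - mu * t.
Proof.
have -> : mu = 2 - (t + t^-1) by rewrite t_mu subKr.
by field.
Qed.

Lemma pfunM_inv z : z != 0 -> pfun t z * pfun t^-1 z = 1 - mu / z ^+ 2.
Proof.
move=> z0; rewrite /pfun.
have -> : (1 + (t - 1) * hfun z) * (1 + (t^-1 - 1) * hfun z) =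
    1 + (t + t^-1 - 2) * (hfun z * (1 - hfun z)) by field.
by rewrite hfunM1B t_mu; ring.
Qed.

Lemma cmod_hfun_le_half z : 2 <= cmod z -> cmod (hfun z) <= 1 / 2.
Proof.
move=> z2; apply: le_trans (cmod_hfun_le z) _.
by rewrite ler_pdivrMr ?exprn_gt0; nra.
Qed.

Lemma cmod_pfun_le s z : 2 <= cmod z -> cmod (pfun s z) <= 1 + cmod (s - 1).
Proof.
move=> /cmod_hfun_le_half hz; apply: le_trans (le_cmodD _ _) _.
rewrite cmod1 lerD2l cmodM; have := cmod_ge0 (s - 1); nra.
Qed.

(** The product of the two is 1 - mu/z^2 and each is at most T, so a lower bound d on the product
    suffices: it is at least 1/2 when |z|^2 >= 2 |mu|, and otherwise [delta] over |z|^2 is used. *)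
Lemma pfun_lower_bound : exists2 c : R, 0 < c & forall z, 2 <= cmod z ->
  delta <= cmod (z ^+ 2 - mu) -> c <= cmod (pfun t z) /\ c <= cmod (pfun t^-1 z).
Proof.
pose T := 1 + cmod (t - 1) + cmod (t^-1 - 1).
have T1 : cmod (t - 1) >= 0 := cmod_ge0 _.
have T2 : cmod (t^-1 - 1) >= 0 := cmod_ge0 _.
have T0 : 0 < T by rewrite /T; lra.
pose d := Num.min (1 / 2) (delta / (2 * cmod mu + 1)).
have mu0 := cmod_ge0 mu.
have d0 : 0 < d by rewrite lt_min !divr_gt0 //; lra.
exists (d / T) => [|z z2 dz]; first by rewrite divr_gt0.
have zp : 0 < cmod z by lra.
have zn0 : z != 0 by rewrite -cmod_gt0.
have dD : d <= cmod (1 - mu / z ^+ 2).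
  have [h|h] := leP (2 * cmod mu) (cmod z ^+ 2).
    have := ge_cmodB 1 (mu / z ^+ 2); rewrite cmod1 cmod_div cmodX => e.
    have : cmod mu / cmod z ^+ 2 <= 1 / 2 by rewrite ler_pdivrMr ?exprn_gt0 //; lra.
    by move=> e'; rewrite ge_min; apply/orP; left; lra.
  have -> : 1 - mu / z ^+ 2 = (z ^+ 2 - mu) / z ^+ 2 by field.
  rewrite ge_min; apply/orP; right; rewrite cmod_div cmodX.
  apply: ler_pM => //; first exact: ltW.
    by rewrite invr_ge0; lra.
  by rewrite lef_pV2 ?posrE ?exprn_gt0 //; lra.
rewrite -pfunM_inv // cmodM in dD.
have p1 := cmod_pfun_le t z2; have p2 := cmod_pfun_le t^-1 z2.
have p3 := cmod_ge0 (pfun t z); have p4 := cmod_ge0 (pfun t^-1 z).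
by rewrite !ler_pdivrMr //; split; apply: le_trans dD _; rewrite /T; nra.
Qed.

(** The quotient H satisfies |H - 1| <= A/|z|^2, as p - q = (t - 1/t) h. Near 1 the logarithm is at
    most 4 |H - 1|. Otherwise A/|z|^2 > 1/2, and the crude bound L on the logarithm is absorbed by 2
    L A/|z|^2. *)
Lemma clog_gap_le : exists2 B : R, 0 <= B & forall z, 2 <= cmod z ->
  delta <= cmod (z ^+ 2 - mu) ->
  cmod (clog (pfun t z / pfun t^-1 z)) <= B / cmod z ^+ 2.
Proof.
have [c c0 hc] := pfun_lower_bound.
pose T := 1 + cmod (t - 1) + cmod (t^-1 - 1).
have T1 : cmod (t - 1) >= 0 := cmod_ge0 _.
have T2 : cmod (t^-1 - 1) >= 0 := cmod_ge0 _.
have T0 : 0 < T by rewrite /T; lra.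
pose L := `|ln (c / T)| + `|ln (T / c)| + trigo.pi.
have pi0 := @pi_ge0 R.
have L0 : 0 <= L by rewrite /L; apply: addr_ge0 => //; exact: addr_ge0.
pose A := cmod (t - t^-1) * 2 / c.
have A0 : 0 <= A by rewrite /A divr_ge0 ?mulr_ge0 ?cmod_ge0 // ltW.
exists (4 * A + 2 * L * A) => [|z z2 dz]; first by nra.
have zp : 0 < cmod z by lra.
have [cp cq] := hc z z2 dz.
have p1 := cmod_pfun_le t z2; have p2 := cmod_pfun_le t^-1 z2.
have q0 : 0 < cmod (pfun t^-1 z) by lra.
have p0 : 0 < cmod (pfun t z) by lra.
have qn0 : pfun t^-1 z != 0 by rewrite -cmod_gt0.
have pn0 : pfun t z != 0 by rewrite -cmod_gt0.
set H := pfun t z / pfun t^-1 z.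
have near1 : cmod (H - 1) <= A / cmod z ^+ 2.
  have -> : H - 1 = (t - t^-1) * hfun z / pfun t^-1 z.
    by rewrite -[X in H - X](divff qn0) -mulrBl; congr (_ / _); rewrite /pfun; ring.
  rewrite cmod_div cmodM.
  have -> : A / cmod z ^+ 2 = cmod (t - t^-1) * (2 / cmod z ^+ 2) / c by rewrite /A; ring.
  apply: ler_pM.
  - by rewrite mulr_ge0 ?cmod_ge0.
  - by rewrite invr_ge0 cmod_ge0.
  - by rewrite ler_wpM2l ?cmod_ge0 ?cmod_hfun_le.
  - by rewrite lef_pV2 ?posrE.
have Az : 0 <= A / cmod z ^+ 2 := le_trans (cmod_ge0 _) near1.
have Hn0 : H != 0 by rewrite mulf_neq0 ?invr_eq0.
have [h|h] := leP (cmod (H - 1)) (1 / 2).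
  apply: le_trans (cmod_clog_near1 h) _; rewrite mulrDl -!mulrA.
  have : 0 <= 2 * (L * (A / cmod z ^+ 2)).
    by apply: mulr_ge0 => //; apply: mulr_ge0.
  lra.
have HL : cmod (clog H) <= L.
  apply: le_trans (cmod_clog_le Hn0) _; rewrite lerD2r cmod_div.
  set r := cmod _ / cmod _.
  have r0 : 0 < r by rewrite divr_gt0.
  have rl : c / T <= r by apply: ler_pM; rewrite ?invr_ge0 ?lef_pV2 ?posrE /T //; lra.
  have ru : r <= T / c by apply: ler_pM; rewrite ?invr_ge0 ?lef_pV2 ?posrE /T //; lra.
  have : ln (c / T) <= ln r by rewrite ler_ln ?posrE ?divr_gt0.
  have : ln r <= ln (T / c) by rewrite ler_ln ?posrE ?divr_gt0.
  have := ler_norm (ln (T / c)); have := ler_norm (- ln (c / T)); rewrite normrN.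
  have := normr_ge0 (ln (T / c)); have := normr_ge0 (ln (c / T)).
  by move=> *; rewrite ler_norml; apply/andP; split; lra.
apply: le_trans HL _.
have -> : (4 * A + 2 * L * A) / cmod z ^+ 2 =
   4 * (A / cmod z ^+ 2) + 2 * L * (A / cmod z ^+ 2) by ring.
have : 1 / 2 <= A / cmod z ^+ 2 by apply: le_trans near1; exact: ltW.
move: (A / _) => y y2; have : L * (1 / 2) <= L * y by apply: ler_wpM2l.
lra.
Qed.

(** After clearing denominators, (t - 1)^2 = - mu t reduces the quadratic term and leaves a
    polynomial identity once [mu] is expanded. *)
Lemma Gfun_vertex a b w : w ^+ 2 + a ^+ 2 + b ^+ 2 - w * a * b = mu ->
  a != 0 -> b != 0 -> a * b - w != 0 ->
  Gfun t a b w * (1 - mu / (a * b - w) ^+ 2) =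
  Gfun t a (a * b - w) b * Gfun t (a * b - w) b a.
Proof.
move=> vert a0 b0; set m := a * b - w => m0; rewrite /Gfun.
have -> : (1 + (t - 1) * (w / (a * b))) * (1 - mu / m ^+ 2) =
   (a * b + (t - 1) * w) * (m ^+ 2 - mu) / (a * b * m ^+ 2).
  by field; rewrite a0 b0 m0.
have -> : (1 + (t - 1) * (b / (a * m))) * (1 + (t - 1) * (a / (m * b))) =
   (a * b * m ^+ 2 + (t - 1) * m * (a ^+ 2 + b ^+ 2) + (t - 1) ^+ 2 * (a * b)) /
     (a * b * m ^+ 2).
  by field; rewrite a0 b0 m0.
congr (_ / _); rewrite sqr_t_B1 /m -vert; ring.
Qed.

Lemma Gfun_near (rho : R) : 1 < rho -> exists2 K : R, 0 <= K & forall a b w,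
  2 * rho <= cmod a -> 2 * rho <= cmod b ->
  cmod w <= Num.max (cmod a) (cmod b) ->
  w ^+ 2 + a ^+ 2 + b ^+ 2 - w * a * b = mu ->
  delta <= cmod (a ^+ 2 - mu) -> delta <= cmod (b ^+ 2 - mu) ->
  cmod (Gfun t a b w / (pfun t a * pfun t b) - 1) <=
    K / Num.max (cmod a) (cmod b) ^+ 2.
Proof.
move=> rho1; have [c c0 hc] := pfun_lower_bound.
set E := edge_const mu (2 * rho).
have E0 : 0 <= E.
  have e1 : 0 <= 1 + cmod mu / 4 by rewrite addr_ge0 ?divr_ge0 ?cmod_ge0.
  have e2 : 0 <= 1 / 2 - 1 / (2 * rho).
    by rewrite subr_ge0 !mul1r lef_pV2 ?posrE //; lra.
  by rewrite /E /edge_const addr_ge0 // divr_ge0.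
set u := cmod (t - 1); have u0 : 0 <= u := cmod_ge0 _.
exists ((u * E + u ^+ 2) / c ^+ 2) => [|a b w ra rb wab vert da db].
  by rewrite divr_ge0 ?addr_ge0 ?mulr_ge0 ?exprn_ge0 // ltW.
have a2 : 2 <= cmod a by lra.
have b2 : 2 <= cmod b by lra.
have [pa _] := hc a a2 da; have [pb _] := hc b b2 db.
have pa0 : 0 < cmod (pfun t a) by lra.
have pb0 : 0 < cmod (pfun t b) by lra.
have pan : pfun t a != 0 by rewrite -cmod_gt0.
have pbn : pfun t b != 0 by rewrite -cmod_gt0.
have rho2 : 2 < 2 * rho by lra.
have e1 := hfun2_near_edge rho2 ra rb wab vert; rewrite -/E in e1.
set M := Num.max _ _ in e1 wab *.
have -> : Gfun t a b w / (pfun t a * pfun t b) - 1 =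
   ((t - 1) * (w / (a * b) - (hfun a + hfun b)) - (t - 1) ^+ 2 * (hfun a * hfun b)) /
     (pfun t a * pfun t b).
  have -> : Gfun t a b w / (pfun t a * pfun t b) - 1 =
     (Gfun t a b w - pfun t a * pfun t b) / (pfun t a * pfun t b).
    by rewrite mulrBl divff // mulf_neq0.
  by congr (_ / _); rewrite /Gfun /pfun; ring.
rewrite cmod_div cmodM.
have -> : (u * E + u ^+ 2) / c ^+ 2 / M ^+ 2 =
   (u * (E / M ^+ 2) + u ^+ 2 * (1 / M ^+ 2)) / (c ^+ 2) by ring.
apply: ler_pM; rewrite ?cmod_ge0 ?invr_ge0 ?mulr_ge0 ?cmod_ge0 //; last first.
  by rewrite lef_pV2 ?posrE ?mulr_gt0 ?exprn_gt0 // expr2 ler_pM // ltW.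
apply: le_trans (le_cmodB _ _) _.
rewrite (cmodM (t - 1)) (cmodM (_ ^+ 2)) cmodX (cmodM (hfun a)) -/u.
have ha := cmod_hfun_le_half a2; have hb := cmod_hfun_le_half b2.
have ha' := cmod_hfun_le a; have hb' := cmod_hfun_le b.
have h0a := cmod_ge0 (hfun a); have h0b := cmod_ge0 (hfun b).
apply: lerD; first by rewrite ler_wpM2l.
rewrite ler_wpM2l ?exprn_ge0 //.
have m1 : cmod (hfun a) * cmod (hfun b) <= 1 / 2 * (2 / cmod b ^+ 2) by exact: ler_pM.
have m2 : cmod (hfun a) * cmod (hfun b) <= 2 / cmod a ^+ 2 * (1 / 2) by exact: ler_pM.
rewrite /M maxEle; case: ifP => _.
  by apply: le_trans m1 _; lra.
by apply: le_trans m2 _; lra.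
Qed.

End HyperbolicGap.

(** * Recurrence of rotations and of the values at the integers *)

Section Recurrence.
Variable R : realType.
Local Notation pi := (@trigo.pi R).

Definition cis (a : R) : R[i] := cexp (0 +i* a).

(* Dirichlet's pigeonhole argument, on multiples of [M + 1]. *)
Lemma cis_recurrent (theta : R) (M : nat) (e : R) : 0 < e ->
  exists n : nat, (M < n)%N /\ cmod (cis (n%:R * theta) - 1) <= e.
Proof.
move=> e0; have p0 := @pi_gt0 R.
pose T := 6 * pi * expR (2 * pi).
have T0 : 0 < T by rewrite mulr_gt0 ?expR_gt0 //; lra.
pose K := (Num.truncn (T / e)).+1.
have KT : T / K%:R <= e.
  rewrite ler_pdivrMr ?ltr0n // mulrC -ler_pdivrMr //.
  exact/ltW/truncnS_gt.
pose v (i : nat) : R := i%:R * M.+1%:R * theta / (2 * pi).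
pose f i := v i - (Num.floor (v i))%:~R.
have fI i : 0 <= f i < 1.
  by have /andP[] := floor_itv (v i); rewrite /f intrD; lra.
have K0 : (0 : R) < K%:R by rewrite ltr0n.
have Kf0 i : 0 <= K%:R * f i by have /andP[f0 _] := fI i; rewrite mulr_ge0 // ltW.
have cellP (i : nat) : (Num.truncn (K%:R * f i) < K)%N.
  have /andP[f0 f1] := fI i.
  by rewrite truncn_lt_nat // gtr_pMr.
pose cell (i : 'I_K.+1) : 'I_K := Ordinal (cellP i).
have /injectivePn[i [j ij cij]] : ~~ injectiveb cell.
  by apply/negP => /injectiveP /leq_card; rewrite !card_ord ltnn.
wlog lij : i j ij cij / (i < j)%N.
  move=> h; have [lij|lji|eij] := ltngtP i j; first exact: (h i j).
    by apply: (h j i) => //; rewrite eq_sym.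
  by move: ij; rewrite -val_eqE /= eij eqxx.
exists ((j - i) * M.+1)%N; split; first by rewrite leq_pmull // subn_gt0.
pose a := 2 * pi * (f j - f i).
have aK : `|f j - f i| <= 1 / K%:R.
  rewrite ler_pdivlMr // -[K%:R]gtr0_norm // -normrM mulrC mulrBr.
  have /andP[] := truncn_itv (Kf0 j); have /andP[] := truncn_itv (Kf0 i).
  have -> : Num.truncn (K%:R * f i) = Num.truncn (K%:R * f j).
    exact: (congr1 val cij).
  by rewrite -natr1 ler_norml; lra.
have -> : cis (((j - i) * M.+1)%N%:R * theta) = cis a.
  rewrite /cis.
  have -> : 0 +i* (((j - i) * M.+1)%N%:R * theta) =
     (0 +i* a) + (Num.floor (v j) - Num.floor (v i))%:~R * (0 +i* (2 * pi)).
    rewrite -(rmorph_int (real_complex R)) intrD rmorphN /=.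
    apply/eqP; rewrite eq_complex /= !mulr0 !mul0r subr0 addr0 eqxx /=; apply/eqP.
    rewrite natrM natrB; last exact: ltnW.
    rewrite /a /f; set fj := (Num.floor _)%:~R; set fi := (Num.floor _)%:~R; rewrite /v.
    by move: (lt0r_neq0 p0); generalize pi => q qn0; field.
  by rewrite cexpD cexp_int_period mulr1.
apply: le_trans (cmod_cexpB1_le _) _.
have -> : cmod (0 +i* a) = `|a| by rewrite /cmod /= expr0n add0r sqrtr_sqr.
have K1 : 1 <= K%:R :> R by rewrite ler1n.
have a1 : `|a| <= 2 * pi / K%:R.
  rewrite /a normrM gtr0_norm ?mulr_gt0 //.
  have -> : 2 * pi / K%:R = 2 * pi * (1 / K%:R) by ring.
  by rewrite ler_wpM2l // ltW // mulr_gt0.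
have a2 : `|a| <= 2 * pi.
  apply: le_trans a1 _; rewrite ler_pdivrMr //.
  by apply: ler_peMr => //; rewrite ltW // mulr_gt0.
apply: le_trans KT; rewrite /T.
have -> : 6 * pi * expR (2 * pi) / K%:R = 3 * (2 * pi / K%:R) * expR (2 * pi) by ring.
apply: ler_pM; rewrite ?expR_ge0 ?ler_expR ?mulr_ge0 //.
by rewrite ler_wpM2l.
Qed.

Lemma cis_recurrence_times (theta : R) : exists Nk : nat -> nat,
  [/\ forall k, (0 < Nk k)%N, forall i j, (i < j)%N -> (Nk i < Nk j)%N &
     (fun k => cmod (cis ((Nk k)%:R * theta) - 1)) @ \oo --> (0 : R)].
Proof.
have hg (M k : nat) : {n : nat | (M < n)%N /\ cmod (cis (n%:R * theta) - 1) <= k.+1%:R^-1}.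
  by apply: cid; apply: cis_recurrent; rewrite invr_gt0.
pose Nk := fix N k := if k is k'.+1 then sval (hg (N k') k) else sval (hg 0%N 0%N).
have Nk_le k : cmod (cis ((Nk k)%:R * theta) - 1) <= k.+1%:R^-1.
  by case: k => [|k] /=; [have [] := svalP (hg 0%N 0%N)|have [] := svalP (hg (Nk k) k.+1)].
have NkS k : (Nk k < Nk k.+1)%N by have [] := svalP (hg (Nk k) k.+1).
exists Nk; split.
- case=> [|k]; first by have [] := svalP (hg 0%N 0%N).
  exact: leq_ltn_trans (NkS k).
- by move=> i j; elim: j => // j IHj; rewrite ltnS leq_eqVlt => /orP[/eqP ->//|/IHj h];
    exact: ltn_trans (NkS j).
- apply: (@squeeze_cvgr _ _ _ _ (cst 0) (fun k => k.+1%:R^-1)).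
  + by apply: nearW => k; rewrite cmod_ge0 Nk_le.
  + exact: cvg_cst.
  + exact: cvg_harmonic.
Qed.

Variables (s : R) (y : nat -> R[i]).
Hypothesis s_itv : -2 < s < 2.
Hypothesis y_rec : forall n, s%:C * y n.+1 = y n + y n.+2.

Let theta := acos (s / 2).
Let P := y 0%N.
Let Q := (y 1%N - y 0%N * (cos theta)%:C) / (sin theta)%:C.

Let s2_itv : -1 <= s / 2 <= 1.
Proof. by have /andP[] := s_itv => *; apply/andP; split; lra. Qed.

Let cos_theta : s = 2 * cos theta.
Proof. by rewrite /theta acosK ?in_itv //=; field. Qed.

Let sin_theta : sin theta != 0.
Proof.
rewrite /theta sin_acos // gt_eqF // sqrtr_gt0.
by have /andP[] := s_itv => *; nra.
Qed.

(** As |s| < 2, the characteristic roots of the recurrence are the distinct numbers e^(i theta) and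
    e^(-i theta). [P] and [Q] fit the values at 0 and 1. *)
Let yE n : y n = P * (cos (n%:R * theta))%:C + Q * (sin (n%:R * theta))%:C.
Proof.
suff [] : y n = P * (cos (n%:R * theta))%:C + Q * (sin (n%:R * theta))%:C /\
  y n.+1 = P * (cos (n.+1%:R * theta))%:C + Q * (sin (n.+1%:R * theta))%:C by [].
have th (m : nat) : (m.+1%:R * theta : R) = m%:R * theta + theta.
  by rewrite -natr1 mulrDl mul1r.
elim: n => [|n [IH1 IH2]]; split => //.
- by rewrite mul0r cos0 sin0 mulr1 mulr0 addr0.
- rewrite mul1r /Q divfK; last by rewrite (inj_eq (@complexI R)).
  by rewrite addrC subrK.
- have -> : y n.+2 = s%:C * y n.+1 - y n by rewrite y_rec addrAC subrr add0r.
  rewrite IH1 IH2 cos_theta !th; set u := n%:R * theta.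
  have c2 : cos (u + theta + theta) = 2 * cos theta * cos (u + theta) - cos u.
    rewrite -{3}(addrK theta u) cosB cosD; ring.
  have s2 : sin (u + theta + theta) = 2 * cos theta * sin (u + theta) - sin u.
    rewrite -{3}(addrK theta u) sinB sinD; ring.
  by rewrite c2 s2 !rmorphB !rmorphM /=; ring.
Qed.

Lemma quasiperiodic_bounded : exists M : R, forall n, cmod (y n) <= M.
Proof.
exists (cmod P + cmod Q) => n; rewrite yE; apply: le_trans (le_cmodD _ _) _.
rewrite (cmodM P) (cmodM Q) !cmod_real; apply: lerD; apply: ler_piMr;
  by rewrite ?cmod_ge0 ?cos_max ?sin_max.
Qed.

(** By the addition formulas y_(n+1) is also a combination of cos(n theta) and sin(n theta), with
    y_1 as coefficient of the cosine; hence the same times serve both limits. *)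
Lemma quasiperiodic_recurrent : exists Nk : nat -> nat,
  [/\ forall k, (0 < Nk k)%N, forall i j, (i < j)%N -> (Nk i < Nk j)%N,
     (fun k => y (Nk k)) @ \oo --> y 0%N & (fun k => y (Nk k).+1) @ \oo --> y 1%N].
Proof.
have [Nk [N0 Ninc Nc]] := cis_recurrence_times theta.
have near (u v : R[i]) (a : R) :
    cmod (u * (cos a)%:C + v * (sin a)%:C - u) <= (cmod u + cmod v) * cmod (cis a - 1).
  have -> : u * (cos a)%:C + v * (sin a)%:C - u = u * (cos a - 1)%:C + v * (sin a)%:C.
    by rewrite rmorphB /=; ring.
  apply: le_trans (le_cmodD _ _) _; rewrite !cmodM !cmod_real mulrDl.
  have := Re_le_cmod (cis a - 1); have := Im_le_cmod (cis a - 1).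
  rewrite ReD ImD ReN ImN /= expR0 !mul1r oppr0 addr0 => h1 h2.
  by apply: lerD; rewrite ler_wpM2l ?cmod_ge0.
have cvg_near (u v : R[i]) :
    (fun k => u * (cos ((Nk k)%:R * theta))%:C + v * (sin ((Nk k)%:R * theta))%:C) @ \oo --> u.
  apply/cvg_cmodP; apply: (@squeeze_cvgr _ _ _ _ (cst 0)
    (fun k => (cmod u + cmod v) * cmod (cis ((Nk k)%:R * theta) - 1))).
  - by apply: nearW => k; rewrite cmod_ge0 near.
  - exact: cvg_cst.
  - have -> : (0 : R) = (cmod u + cmod v) * 0 by rewrite mulr0.
    exact: cvgMr.
exists Nk; split => //.
  rewrite (_ : (fun k => _) = fun k => P * (cos ((Nk k)%:R * theta))%:C +
     Q * (sin ((Nk k)%:R * theta))%:C) //; by apply/funext => k; rewrite yE.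
have y1 : y 1%N = P * (cos theta)%:C + Q * (sin theta)%:C by rewrite (yE 1) mul1r.
rewrite (_ : (fun k => _) = fun k => y 1%N * (cos ((Nk k)%:R * theta))%:C +
   (Q * (cos theta)%:C - P * (sin theta)%:C) * (sin ((Nk k)%:R * theta))%:C) //.
apply/funext => k; rewrite yE -natr1 mulrDl mul1r y1 cosD sinD.
by rewrite rmorphB rmorphD !rmorphM /=; ring.
Qed.

End Recurrence.

(** * Telescoping around X_(1/0) *)

Section Telescoping.
Variables (R : realType) (mu x : R[i]) (y : nat -> R[i]) (M delta : R).
Hypothesis mu_neq4 : mu != 4.
Hypothesis y_rec : forall n, x * y n.+1 = y n + y n.+2.
Hypothesis y_vertex : forall n,
  x ^+ 2 + y n ^+ 2 + y n.+1 ^+ 2 - x * y n * y n.+1 = mu.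
Hypothesis y_gt2 : forall n, 2 < cmod (y n).
Hypothesis y_le : forall n, cmod (y n) <= M.
Hypothesis delta_gt0 : 0 < delta.
Hypothesis y_delta : forall n, delta <= cmod (y n ^+ 2 - mu).

Let y_neq0 n : y n != 0.
Proof. by rewrite -cmod_gt0; apply: lt_trans (y_gt2 n). Qed.

Let y_rec' n : y n.+2 = x * y n.+1 - y n.
Proof. by rewrite y_rec addrAC subrr add0r. Qed.

Let y_ratio_le n : cmod (y n.+1 / y n) <= M / 2.
Proof.
rewrite cmod_div; apply: ler_pM; rewrite ?invr_ge0 ?cmod_ge0 //.
rewrite lef_pV2 ?posrE //; last by apply: lt_trans (y_gt2 n).
exact: ltW.
Qed.

(** The third clause is the continuity of V_n in (y_n, y_(n+1)), tested along index sequences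
    returning to the initial pair. *)
Definition potential (ratio : nat -> R[i]) (V : nat -> R[i]) : Prop :=
  [/\ forall n, ratio n = V n.+1 / V n,
      exists c C : R, 0 < c /\ forall n, c <= cmod (V n) <= C &
      forall Nk : nat -> nat, (fun k => y (Nk k)) @ \oo --> y 0%N ->
        (fun k => y (Nk k).+1) @ \oo --> y 1%N -> (fun k => V (Nk k)) @ \oo --> V 0%N].

Section Hyperbolic.
Variable t : R[i].
Hypothesis mu_neq0 : mu != 0.
Hypothesis t_neq0 : t != 0.
Hypothesis t_mu : t + t^-1 = 2 - mu.

Local Notation p n := (pfun t (y n)).
Local Notation q n := (pfun t^-1 (y n)).
Let D n := 1 - mu / y n ^+ 2.
Let g n := Gfun t (y n) (y n.+1) x.
(** [r n] is x G(x, y_n, y_(n+1)) with the division by x cleared. By the edge relation [l n] is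
    likewise x G(x, y_n, y_(n-1)), written so that it makes sense at n = 0. *)
Let r n := x + (t - 1) * (y n.+1 / y n).
Let l n := t * x - (t - 1) * (y n.+1 / y n).

Let sqr_t_B1 : (t - 1) ^+ 2 = - mu * t.
Proof.
have -> : mu = 2 - (t + t^-1) by rewrite t_mu subKr.
by field.
Qed.

Let pqD n : p n * q n = D n.
Proof. exact: pfunM_inv. Qed.

Let t_neq1 : t - 1 != 0.
Proof. by rewrite -sqrf_eq0 sqr_t_B1 mulNr oppr_eq0 mulf_neq0. Qed.

(** The hypothesis on [mu] enters here, since t = -1 means mu = 4. It keeps [r n + l n] nonzero as
    soon as x is. *)
Let t_neqN1 : t + 1 != 0.
Proof.
apply/negP => /eqP e; move/negP: mu_neq4; apply.
have tE : t = - 1 by apply/eqP; rewrite -subr_eq0 opprK e.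
have -> : mu = 2 - (t + t^-1) by rewrite t_mu subKr.
by rewrite tE invrN invr1; apply/eqP; ring.
Qed.

Let pq_bound : exists c C : R, [/\ 0 < c, 0 < C,
  forall n, c <= cmod (p n) <= C & forall n, c <= cmod (q n) <= C].
Proof.
have [c c0 hc] := pfun_lower_bound t_neq0 t_mu delta_gt0.
have T1 : cmod (t - 1) >= 0 := cmod_ge0 _.
have T2 : cmod (t^-1 - 1) >= 0 := cmod_ge0 _.
exists c, (1 + cmod (t - 1) + cmod (t^-1 - 1)); split => //; first by lra.
  move=> n; have y2 := ltW (y_gt2 n); have [-> _] := hc _ y2 (y_delta n).
  by have := cmod_pfun_le t y2; rewrite /=; lra.
move=> n; have y2 := ltW (y_gt2 n); have [_ ->] := hc _ y2 (y_delta n).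
by have := cmod_pfun_le t^-1 y2; rewrite /=; lra.
Qed.

Let p_neq0 n : p n != 0.
Proof. by have [c [C [c0 _ /(_ n)/andP[h _] _]]] := pq_bound; rewrite -cmod_gt0; lra. Qed.

Let q_neq0 n : q n != 0.
Proof. by have [c [C [c0 _ _ /(_ n)/andP[h _]]]] := pq_bound; rewrite -cmod_gt0; lra. Qed.

Let D_neq0 n : D n != 0.
Proof. by rewrite -pqD mulf_neq0. Qed.

(** This is [Gfun_vertex] for the edge (x, y_(n+1)) with y_(n+2) behind it and mediant value y_n,
    multiplied by x; [g_l] is its mirror image. *)
Let g_r n : g n * r n = D n * r n.+1.
Proof.
have y0 := y_neq0 n; have y1 := y_neq0 n.+1.
rewrite /g /r /D /Gfun y_rec'.
have -> : (1 + (t - 1) * (x / (y n * y n.+1))) * (x + (t - 1) * (y n.+1 / y n)) =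
  (x * y n ^+ 2 * y n.+1 + (t - 1) * (y n * y n.+1 ^+ 2 + x ^+ 2 * y n) +
   (t - 1) ^+ 2 * (x * y n.+1)) / (y n ^+ 2 * y n.+1) by field; rewrite y0 y1.
have -> : (1 - mu / y n ^+ 2) * (x + (t - 1) * ((x * y n.+1 - y n) / y n.+1)) =
  (y n ^+ 2 - mu) * (t * x * y n.+1 - (t - 1) * y n) / (y n ^+ 2 * y n.+1).
  by field; rewrite y0 y1.
congr (_ / _); rewrite sqr_t_B1 -(y_vertex n); ring.
Qed.

Let g_l n : g n * l n.+1 = D n.+1 * l n.
Proof.
have y0 := y_neq0 n; have y1 := y_neq0 n.+1.
rewrite /g /l /D /Gfun y_rec'.
have -> : (1 + (t - 1) * (x / (y n * y n.+1))) *
    (t * x - (t - 1) * ((x * y n.+1 - y n) / y n.+1)) =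
  (x * y n.+1 ^+ 2 * y n + (t - 1) * (y n.+1 * y n ^+ 2 + x ^+ 2 * y n.+1) +
   (t - 1) ^+ 2 * (x * y n)) / (y n.+1 ^+ 2 * y n) by field; rewrite y0 y1.
have -> : (1 - mu / y n.+1 ^+ 2) * (t * x - (t - 1) * (y n.+1 / y n)) =
  (y n.+1 ^+ 2 - mu) * (t * x * y n - (t - 1) * y n.+1) / (y n.+1 ^+ 2 * y n).
  by field; rewrite y0 y1.
congr (_ / _); rewrite sqr_t_B1 -(y_vertex n); ring.
Qed.

Let r_l n : r n * l n = t * (x ^+ 2 - mu) * D n.
Proof.
have y0 := y_neq0 n; rewrite /r /l /D.
have -> : (x + (t - 1) * (y n.+1 / y n)) * (t * x - (t - 1) * (y n.+1 / y n)) =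
  (t * x ^+ 2 * y n ^+ 2 + (t - 1) ^+ 2 * (x * y n * y n.+1 - y n.+1 ^+ 2)) / y n ^+ 2.
  by field.
have -> : t * (x ^+ 2 - mu) * (1 - mu / y n ^+ 2) =
  t * (x ^+ 2 - mu) * (y n ^+ 2 - mu) / y n ^+ 2 by field.
congr (_ / _); rewrite sqr_t_B1 -(y_vertex n); ring.
Qed.

Let rDl n : r n + l n = (t + 1) * x.
Proof. by rewrite /r /l; ring. Qed.

(** The values of G for t and 1/t multiply to D_n D_(n+1), as p and q do for D. *)
Let g_neq0 n : g n != 0.
Proof.
have y0 := y_neq0 n; have y1 := y_neq0 n.+1.
have : g n * Gfun t^-1 (y n) (y n.+1) x = D n * D n.+1.
  rewrite /g /Gfun /D.
  have -> : (1 + (t - 1) * (x / (y n * y n.+1))) * (1 + (t^-1 - 1) * (x / (y n * y n.+1)))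
    = (y n ^+ 2 * y n.+1 ^+ 2 + (t + t^-1 - 2) * (x * y n * y n.+1 - x ^+ 2))
       / (y n ^+ 2 * y n.+1 ^+ 2) by field; rewrite t_neq0 y0 y1.
  have -> : (1 - mu / y n ^+ 2) * (1 - mu / y n.+1 ^+ 2) =
     (y n ^+ 2 - mu) * (y n.+1 ^+ 2 - mu) / (y n ^+ 2 * y n.+1 ^+ 2).
     by field; rewrite y0 y1.
  congr (_ / _); rewrite t_mu -(y_vertex n); ring.
by apply: contra_eq_neq => ->; rewrite mul0r eq_sym mulf_neq0.
Qed.

Let ratio n := g n / (p n * p n.+1) * (p n.+1 / q n.+1).

Let B := cmod x + cmod (t * x) + cmod (t - 1) * (M / 2) + 1.

Let B_gt0 : 0 < B.
Proof.
have := cmod_ge0 x; have := cmod_ge0 (t * x); have := cmod_ge0 (t - 1).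
have : 0 <= M / 2 := le_trans (cmod_ge0 _) (y_ratio_le 0).
by rewrite /B; nra.
Qed.

Let r_le n : cmod (r n) <= B.
Proof.
have h : cmod (t - 1) * cmod (y n.+1 / y n) <= cmod (t - 1) * (M / 2).
  by rewrite ler_wpM2l ?cmod_ge0.
apply: le_trans (le_cmodD _ _) _; rewrite (cmodM (t - 1)) /B.
have := cmod_ge0 (t * x); lra.
Qed.

Let l_le n : cmod (l n) <= B.
Proof.
have h : cmod (t - 1) * cmod (y n.+1 / y n) <= cmod (t - 1) * (M / 2).
  by rewrite ler_wpM2l ?cmod_ge0.
apply: le_trans (le_cmodB _ _) _; rewrite (cmodM (t - 1)) /B.
have := cmod_ge0 x; lra.
Qed.

(** If l_0 = 0, then l vanishes identically by [g_l] and r is constant. Otherwise x^2 - mu is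
    nonzero, |r l| is bounded below through D = p q, and |l| is bounded above by [B]. *)
Let r_bounded_below : r 0%N != 0 -> exists2 c : R, 0 < c & forall n, c <= cmod (r n).
Proof.
move=> r0; have [l0|l0] := eqVneq (l 0%N) 0.
  have ln n : l n = 0.
    elim: n => // n IHn; have := g_l n; rewrite IHn mulr0 => /eqP.
    by rewrite mulf_eq0 (negbTE (g_neq0 n)) => /eqP.
  have rn n : r n = r 0%N by have := rDl n; have := rDl 0; rewrite !ln !addr0 => -> ->.
  by exists (cmod (r 0%N)) => [|n]; rewrite ?cmod_gt0 // rn.
have xmu : x ^+ 2 - mu != 0.
  by apply: contraNneq (mulf_neq0 r0 l0) => e; rewrite r_l e mulr0 mul0r.
have [c [C [c0 _ hp hq]]] := pq_bound.
set k := cmod (t * (x ^+ 2 - mu)).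
have k0 : 0 < k by rewrite cmod_gt0 mulf_neq0.
exists (k * c ^+ 2 / B) => [|n]; first by rewrite divr_gt0 // mulr_gt0 // exprn_gt0.
rewrite ler_pdivrMr //; apply: (@le_trans _ _ (cmod (r n) * cmod (l n))).
  rewrite -cmodM r_l cmodM -pqD (cmodM (p n)) -/k ler_wpM2l ?(ltW k0) // expr2.
  have /andP[h1 _] := hp n; have /andP[h2 _] := hq n.
  by apply: ler_pM => //; exact: ltW.
by rewrite ler_wpM2l ?cmod_ge0.
Qed.

Let cvg_y_ratio (Nk : nat -> nat) : (fun k => y (Nk k)) @ \oo --> y 0%N ->
  (fun k => y (Nk k).+1) @ \oo --> y 1%N ->
  (fun k => (t - 1) * (y (Nk k).+1 / y (Nk k))) @ \oo --> (t - 1) * (y 1%N / y 0%N).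
Proof. move=> c0 c1; exact: (cvgMr (cvgM c1 (cvgV (y_neq0 0) c0))). Qed.

Let cvg_pfun (s : R[i]) (Nk : nat -> nat) : (fun k => y (Nk k)) @ \oo --> y 0%N ->
  (fun k => pfun s (y (Nk k))) @ \oo --> pfun s (y 0%N).
Proof.
move=> c0; exact: (cvgD (cvg_cst _) (cvgMr (cvg_hfun (y_gt2 0) c0))).
Qed.

(* [r] vanishes nowhere or everywhere; in the latter case [r n + l n = (t + 1) x]
   shows that [l] is a nonzero constant, and [p/l] replaces [r/q]. *)
Lemma hyperbolic_potential : exists V, potential ratio V.
Proof.
have [c [C [c0 C0 hp hq]]] := pq_bound.
have [r0|r0] := eqVneq (r 0%N) 0; last first.
  have [c' c'0 hr] := r_bounded_below r0.
  have rn n : r n != 0 by rewrite -cmod_gt0 (lt_le_trans c'0).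
  exists (fun n => r n / q n); split.
  - move=> n; rewrite /ratio.
    have e := g_r n; rewrite -pqD in e.
    have -> : g n = p n * q n * r n.+1 / r n by rewrite -e mulfK.
    by field; rewrite !p_neq0 !q_neq0 rn.
  - exists (c' / C), (B / c); split=> [|n]; first by rewrite divr_gt0.
    have /andP[h1 h2] := hq n; rewrite cmod_div; apply/andP; split.
      apply: ler_pM; rewrite ?invr_ge0 ?(ltW c'0) ?(ltW C0) ?hr //.
      by rewrite lef_pV2 ?posrE //; lra.
    apply: ler_pM; rewrite ?invr_ge0 ?cmod_ge0 ?r_le //.
    by rewrite lef_pV2 ?posrE //; lra.
  - move=> Nk cy0 cy1.
    apply: cvgM.
      by apply: cvgD; [exact: cvg_cst | exact: cvg_y_ratio cy0 cy1].
    apply: (cvgV (q_neq0 0)); exact: (cvg_pfun (s:=t^-1) cy0).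
have rn n : r n = 0.
  elim: n => // n IHn; have := g_r n; rewrite IHn mulr0 => /esym/eqP.
  by rewrite mulf_eq0 (negbTE (D_neq0 n)) => /eqP.
have ln n : l n = (t + 1) * x by rewrite -(rDl n) rn add0r.
have xn0 : x != 0.
  apply: contra_eq_neq r0 => x0; rewrite /r x0 add0r mulf_neq0 // mulf_neq0 //.
  by rewrite invr_eq0.
have lx0 : (t + 1) * x != 0 by rewrite mulf_neq0.
exists (fun n => p n / ((t + 1) * x)); split.
- move=> n; rewrite /ratio.
  have e := g_l n; rewrite !ln -pqD in e.
  have -> : g n = p n.+1 * q n.+1 by apply: (mulIf lx0).
  by field; rewrite !p_neq0 !q_neq0 t_neqN1 xn0.
- set k := cmod ((t + 1) * x); have k0 : 0 < k by rewrite cmod_gt0.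
  exists (c / k), (C / k); split=> [|n]; first by rewrite divr_gt0.
  by rewrite cmod_div -/k !ler_pM2r ?invr_gt0.
- move=> Nk cy0 _; apply: cvgM; last exact: cvg_cst.
  exact: (cvg_pfun (s:=t) cy0).
Qed.

End Hyperbolic.

Section Parabolic.
Hypothesis mu0 : mu = 0.

Let s n := y n.+1 / (x * y n).

(** For mu = 0 the vertex relation gives y_(n+2) y_n - y_(n+1)^2 = x^2, that is x/(y_n y_(n+1)) =
    s_(n+1) - s_n, so the exponents telescope. *)
Lemma parabolic_potential : exists V, potential (fun n =>
  cexp (x / (y n * y n.+1) / 2) / (cexp (hfun (y n) / 2) * cexp (hfun (y n.+1) / 2)) *
    cexp (hfun (y n.+1))) V.
Proof.
exists (fun n => cexp ((s n + hfun (y n)) / 2)); split.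
- move=> n; rewrite -!cexpD -!cexpB -cexpD; congr cexp.
  have -> : x / (y n * y n.+1) = s n.+1 - s n.
    have y0 := y_neq0 n; have y1 := y_neq0 n.+1.
    (* For x = 0, [s] is identically 0 by the convention on division, and both sides vanish. *)
    have [x0|xn0] := eqVneq x 0; first by rewrite /s x0 !mul0r invr0 !mulr0 subrr.
    have E : x ^+ 2 = y n.+2 * y n - y n.+1 ^+ 2.
      apply/eqP; rewrite -subr_eq0 -mu0 -(y_vertex n) y_rec'; apply/eqP; ring.
    have -> : s n.+1 - s n = (y n.+2 * y n - y n.+1 ^+ 2) / (x * y n * y n.+1).
      by rewrite /s; field; rewrite xn0 y0 y1.
    by rewrite -E; field; rewrite xn0 y0 y1.
  by field.
- pose K := cmod x^-1 * (M / 2) + 1.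
  exists (expR (- K)), (expR K); split=> [|n]; first exact: expR_gt0.
  rewrite cmod_cexp !ler_expR -ler_norml.
  apply: le_trans (Re_le_cmod _) _; rewrite cmod_div cmod_nat.
  have h0 := y_ratio_le n.
  have h1 : cmod (hfun (y n)) <= 1 / 2 by apply: cmod_hfun_le_half; exact: ltW.
  have h2 : cmod (s n) <= cmod x^-1 * (M / 2).
    have -> : s n = x^-1 * (y n.+1 / y n) by rewrite /s invfM; ring.
    by rewrite (cmodM x^-1) ler_wpM2l ?cmod_ge0.
  have := le_cmodD (s n) (hfun (y n)); have := cmod_ge0 (s n).
  by rewrite ler_pdivrMr // /K; lra.
- move=> Nk cy0 cy1; apply: cvg_cexp; apply: cvgM; last exact: cvg_cst.
  apply: cvgD; last exact: cvg_hfun.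
  rewrite /s (_ : (fun k => _) = fun k => x^-1 * (y (Nk k).+1 / y (Nk k))); last first.
    by apply/funext => k; rewrite invfM; ring.
  have -> : y 1%N / (x * y 0%N) = x^-1 * (y 1%N / y 0%N) by rewrite invfM; ring.
  apply: cvgMr; exact: (cvgM cy1 (cvgV (y_neq0 0) cy0)).
Qed.

End Parabolic.

End Telescoping.

(** * From a bounded potential to the two limits *)

Section Assembly.
Variables (R : realType) (F : rat -> R[i]) (V : nat -> R[i]) (c C : R).
Hypothesis c_gt0 : 0 < c.
Hypothesis V_bound : forall n, c <= cmod (V n) <= C.
Hypothesis cexp_sumE : forall N, cexp (rat_sum F N) = V N / V 0%N.

Let V_gt0 n : 0 < cmod (V n).
Proof. by have /andP[h _] := V_bound n; apply: lt_le_trans h. Qed.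

(** The real part of the sum is ln |V_N / V_0|, bounded independently of N. *)
Lemma cvg_Re_rat_sum_div :
  (fun N : nat => complex.Re (rat_sum F N / N%:R)) @ \oo --> (0 : R).
Proof.
pose L := `|ln (c / C)| + `|ln (C / c)|.
have C0 : 0 < C.
  by have /andP[h1 h2] := V_bound 0%N; apply: lt_le_trans c_gt0 (le_trans h1 h2).
have ReS N : `|complex.Re (rat_sum F N)| <= L.
  have E : complex.Re (rat_sum F N) = ln (cmod (V N) / cmod (V 0%N)).
    by rewrite -cmod_div -cexp_sumE cmod_cexp expRK.
  rewrite E; set r := _ / _.
  have /andP[a1 a2] := V_bound N; have /andP[b1 b2] := V_bound 0%N.
  have r0 : 0 < r by rewrite divr_gt0.
  have rl : c / C <= r.
    by apply: ler_pM; rewrite ?invr_ge0 ?lef_pV2 ?posrE ?(ltW c_gt0) ?(ltW C0).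
  have ru : r <= C / c.
    by apply: ler_pM; rewrite ?invr_ge0 ?lef_pV2 ?posrE ?cmod_ge0.
  have : ln (c / C) <= ln r by rewrite ler_ln ?posrE ?divr_gt0.
  have : ln r <= ln (C / c) by rewrite ler_ln ?posrE ?divr_gt0.
  have := ler_norm (ln (C / c)); have := ler_norm (- ln (c / C)); rewrite normrN.
  have := normr_ge0 (ln (C / c)); have := normr_ge0 (ln (c / C)).
  by rewrite /L => *; rewrite ler_norml; apply/andP; split; lra.
have ReE N : complex.Re (rat_sum F N / N%:R) = complex.Re (rat_sum F N) * N%:R^-1.
  rewrite -[N%:R in LHS](rmorph_nat (real_complex R)) -fmorphV /=.
  by case: (rat_sum F N) => a b /=; rewrite mulr0 subr0.
rewrite -cvg_shiftS; apply/norm_cvg0P.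
apply: (@squeeze_cvgr _ _ _ _ (cst 0) (fun N => L * N.+1%:R^-1)).
- apply: nearW => N; rewrite normr_ge0 /= ReE normrM normfV (ger0_norm (ler0n R N.+1)).
  by rewrite ler_wpM2r ?invr_ge0.
- exact: cvg_cst.
- have -> : (0 : R) = L * 0 by rewrite mulr0.
  by apply: cvgMr; exact: cvg_harmonic.
Qed.

Lemma cvg_rat_sum_mod_2pii (Nk : nat -> nat) :
  (fun k => V (Nk k)) @ \oo --> V 0%N ->
  (fun k => to_mod_2pii (rat_sum F (Nk k))) @ \oo --> to_mod_2pii (0 : R[i]).
Proof.
move=> VN; apply: cvg_to_mod_2pii; under eq_fun do rewrite cexp_sumE.
have V0 : V 0%N != 0 by rewrite -cmod_gt0.
have -> : (1 : R[i]) = V 0%N / V 0%N by rewrite divff.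
by apply: cvgM; [exact: VN | exact: cvg_cst].
Qed.

End Assembly.

(** * The values of a Markoff map along the Farey tree *)

Section MarkoffValues.
Variables (R : realType) (mu : R[i]) (phi : Omega -> R[i]) (X : Qinf -> Omega).
Hypothesis hphi : markoff_map mu phi.
Hypothesis hX : identification X.
Hypothesis hOmega2 : Omega2 phi = [set X None].

Local Notation psi r := (phi (X r)).
Local Notation psiq r := (phi (X (Some r))).

Let psi_vertex a b c : farey_neighbors a b -> farey_neighbors b c -> farey_neighbors a c ->
  psi a ^+ 2 + psi b ^+ 2 + psi c ^+ 2 - psi a * psi b * psi c = mu.
Proof. by case: hphi hX => h _ [_ e] ab bc ac; apply: h; rewrite /meet_at_vertex !e ab bc ac. Qed.

Let psi_edge a b c d : farey_neighbors a b ->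
  farey_neighbors b c -> farey_neighbors a c ->
  farey_neighbors b d -> farey_neighbors a d -> c <> d ->
  psi a * psi b = psi c + psi d.
Proof.
case: hphi hX => _ h [bij e] ab bc ac bd ad cd; apply: h.
rewrite /edge_regions /meet_at_vertex !e ab bc ac bd ad; split => //.
by move/(bij_inj bij).
Qed.

Lemma psi_gt2 (r : rat) : 2 < cmod (psiq r).
Proof.
rewrite ltNge; apply/negP => h.
have : Omega2 phi (X (Some r)).
  rewrite /Omega2 /= normE; have -> : 2 = (2 : R)%:C :> R[i] by rewrite rmorph_nat.
  by rewrite lecR.
by rewrite hOmega2 => /(bij_inj hX.1).
Qed.

Lemma psi_tree_left a b : farey_edge a b ->
  psiq a * psiq (mediant a b) = psiq b + psiq (mediant a (mediant a b)).
Proof.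
move=> ab; have am := farey_edge_mediantl ab; have mb := farey_edge_mediantr ab.
have am' := farey_edge_mediantl am; have m'm := farey_edge_mediantr am.
apply: psi_edge; try by [apply: (farey_edge_neighbors _).1 | apply: (farey_edge_neighbors _).2].
by case=> e; have := lt_trans (farey_edge_lt m'm) (farey_edge_lt mb); rewrite -e ltxx.
Qed.

Lemma psi_tree_right a b : farey_edge a b ->
  psiq (mediant a b) * psiq b = psiq a + psiq (mediant (mediant a b) b).
Proof.
move=> ab; have am := farey_edge_mediantl ab; have mb := farey_edge_mediantr ab.
have mm' := farey_edge_mediantl mb; have m'b := farey_edge_mediantr mb.
apply: psi_edge; try by [apply: (farey_edge_neighbors _).1 | apply: (farey_edge_neighbors _).2].
by case=> e; have := lt_trans (farey_edge_lt am) (farey_edge_lt mm'); rewrite -e ltxx.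
Qed.

Local Notation yz z := (psiq z%:~R).

Let neighbors_inf (z : int) : farey_neighbors None (Some z%:~R) /\
  farey_neighbors (Some z%:~R) None.
Proof. by rewrite /farey_neighbors /= numq_int denq_int; split; lia. Qed.

Let neighbors_int (z : int) : farey_neighbors (Some z%:~R) (Some (z + 1)%:~R) /\
  farey_neighbors (Some (z + 1)%:~R) (Some z%:~R).
Proof. exact: farey_edge_neighbors (farey_edge_int z). Qed.

Lemma psi_root z : yz z * yz (z + 1) = psi None + psiq (mediant z%:~R (z + 1)%:~R).
Proof.
have e := farey_edge_int z.
have em := farey_edge_mediantl e; have me := farey_edge_mediantr e.
have [] := neighbors_inf z; have [] := neighbors_inf (z + 1); have [] := neighbors_int z.
move=> *; apply: psi_edge => //.
- exact: (farey_edge_neighbors me).2.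
- exact: (farey_edge_neighbors em).1.
Qed.

Lemma psi_int_vertex z :
  psi None ^+ 2 + yz z ^+ 2 + yz (z + 1) ^+ 2 - psi None * yz z * yz (z + 1) = mu.
Proof.
have [? _] := neighbors_inf z; have [? _] := neighbors_inf (z + 1).
by have [? _] := neighbors_int z; apply: psi_vertex.
Qed.

Lemma psi_int_rec z : psi None * yz (z + 1) = yz z + yz (z + 1 + 1).
Proof.
have [? _] := neighbors_inf z; have [? _] := neighbors_inf (z + 1).
have [? _] := neighbors_inf (z + 1 + 1).
have [_ ?] := neighbors_int z; have [? _] := neighbors_int (z + 1).
apply: psi_edge => // -[/eqP]; rewrite eqr_int -addrA -subr_eq0 opprD addNKr.
by [].
Qed.

Local Notation y n := (psiq n%:R).

Lemma y_rec n : psi None * y n.+1 = y n + y n.+2.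
Proof. by have := psi_int_rec n; rewrite -!PoszD !addn1. Qed.

Lemma y_vertex n :
  psi None ^+ 2 + y n ^+ 2 + y n.+1 ^+ 2 - psi None * y n * y n.+1 = mu.
Proof. by have := psi_int_vertex n; rewrite -!PoszD !addn1. Qed.

Variable s : R.
Hypothesis s_itv : -2 < s < 2.
Hypothesis phi_inf : phi (X None) = s%:C.

(** The relations around X_(1/0) give y_z^2 - mu = y_(z-1) y_(z+1) - x^2. The neighbor z - 1 is the
    reason for working over all integers. *)
Lemma psi_int_delta z : 4 - s ^+ 2 <= cmod (yz z ^+ 2 - mu).
Proof.
have r := psi_int_rec (z - 1); have v := psi_int_vertex z.
rewrite subrK in r.
have -> : yz z ^+ 2 - mu = yz (z - 1) * yz (z + 1) - psi None ^+ 2.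
  have -> : yz (z - 1) = psi None * yz z - yz (z + 1) by rewrite r addrK.
  by rewrite -v; ring.
have h := ge_cmodB (yz (z - 1) * yz (z + 1)) (psi None ^+ 2).
have e : cmod (psi None ^+ 2) = s ^+ 2.
  by rewrite phi_inf cmodX cmod_real real_normK ?num_real.
rewrite e (cmodM (yz (z - 1))) in h.
have := psi_gt2 (z - 1)%:~R; have := psi_gt2 (z + 1)%:~R; nra.
Qed.

Lemma y_delta n : 4 - s ^+ 2 <= cmod (y n ^+ 2 - mu).
Proof. exact: (psi_int_delta n). Qed.

Let delta0_gt0 : 0 < 4 - s ^+ 2.
Proof. by have /andP[? ?] := s_itv; nra. Qed.

(** A minimum over finitely many n. The dependence of [rho] on N is harmless: each sum is evaluated
    separately, and the bounds uniform in N rest on [y_delta]. *)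
Let y_lower N : exists2 rho : R, 1 < rho & forall n, (n <= N)%N -> 2 * rho <= cmod (y n).
Proof.
elim: N => [|N [rho rho1 hr]].
  exists (cmod (y 0%N) / 2) => [|n]; first by have := psi_gt2 (0%:R : rat); lra.
  by rewrite leqn0 => /eqP ->; lra.
exists (Num.min rho (cmod (y N.+1) / 2)) => [|n].
  by rewrite lt_min rho1 /=; have := psi_gt2 (N.+1%:R : rat); lra.
rewrite leq_eqVlt ltnS => /orP[/eqP ->|/hr h].
  by have : Num.min rho (cmod (y N.+1) / 2) <= cmod (y N.+1) / 2; [rewrite ge_min lexx orbT|lra].
by have : Num.min rho (cmod (y N.+1) / 2) <= rho; [rewrite ge_min lexx|lra].
Qed.

Let psi' r := psiq r.

(** [delta] is the smaller of 4 - s^2, which the integers satisfy, and the bound that new vertices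
    satisfy automatically. The value behind each root edge is x, with |x| < 2 < |y_n|. *)
Lemma admissible_roots N : exists rho delta : R,
  [/\ 1 < rho, 0 < delta, delta <= (2 * rho) ^+ 2 * (2 * rho - 2) &
   forall n, (n < N)%N -> admissible psi' mu rho delta n%:R n.+1%:R (psi None)].
Proof.
have [rho rho1 hr] := y_lower N.
pose delta := Num.min (4 - s ^+ 2) ((2 * rho) ^+ 2 * (2 * rho - 2)).
have large_nat n : (n <= N)%N -> large psi' mu rho delta n%:R.
  move=> nN; split; last by apply: le_trans (y_delta n); rewrite ge_min lexx.
  by rewrite (denq_int n) expr1; exact: hr.
exists rho, delta; split => //.
- rewrite lt_min delta0_gt0 mulr_gt0 ?exprn_gt0 //; lra.
- by rewrite ge_min lexx orbT.
move=> n nN; split.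
- exact: farey_edge_nat.
- rewrite phi_inf cmod_real le_max; apply/orP; left; apply: ltW.
  apply: lt_trans (psi_gt2 _); rewrite ltr_norml //.
- exact/large_nat/ltnW.
- exact: large_nat.
- by have := psi_root n; rewrite -!PoszD !addn1.
- exact: y_vertex.
Qed.

Section Gap.
Variables (G : R[i] -> R[i] -> R[i] -> R[i]) (p D H f : R[i] -> R[i]).
Hypothesis G_near : forall rho delta : R, 1 < rho -> 0 < delta ->
  exists2 K : R, 0 <= K & forall a b w,
  2 * rho <= cmod a -> 2 * rho <= cmod b ->
  cmod w <= Num.max (cmod a) (cmod b) ->
  w ^+ 2 + a ^+ 2 + b ^+ 2 - w * a * b = mu ->
  delta <= cmod (a ^+ 2 - mu) -> delta <= cmod (b ^+ 2 - mu) ->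
  cmod (G a b w / (p a * p b) - 1) <= K / Num.max (cmod a) (cmod b) ^+ 2.
Hypothesis G_vertex : forall a b w,
  w ^+ 2 + a ^+ 2 + b ^+ 2 - w * a * b = mu ->
  a != 0 -> b != 0 -> a * b - w != 0 ->
  G a b w * D (a * b - w) = G a (a * b - w) b * G (a * b - w) b a.
Hypothesis pDH : forall z, 2 <= cmod z -> z ^+ 2 != mu ->
  [/\ p z != 0, D z != 0 & H z = p z ^+ 2 / D z].
Hypothesis f_le : forall delta : R, 0 < delta -> exists2 B : R, 0 <= B &
  forall z, 2 <= cmod z -> delta <= cmod (z ^+ 2 - mu) -> cmod (f z) <= B / cmod z ^+ 2.
Hypothesis cexp_f : forall z, 2 <= cmod z -> z ^+ 2 != mu -> cexp (f z) = H z.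

Let F r := f (psiq r).

Lemma gap_rat_sum N : cvg (rat_partial_sum F N @ totally) /\
  cexp (rat_sum F N) = \prod_(0 <= n < N)
    (G (y n) (y n.+1) (psi None) / (p (y n) * p (y n.+1)) * H (y n.+1)).
Proof.
have [rho [delta [rho1 delta0 delta_le roots]]] := admissible_roots N.
have left := admissible_left rho1 delta_le psi_tree_left.
have right := admissible_right rho1 delta_le psi_tree_right.
have med := admissible_mediant rho1 delta_le.
have [K1 K10 hK1] := large_inv_sqr_le psi' mu delta rho1.
have [K2 K20 hK2] := G_near rho1 delta0.
have [B B0 hB] := f_le delta0.
have large_neq a : large psi' mu rho delta a ->
   [/\ 2 <= cmod (psi' a), psi' a ^+ 2 != mu & psi' a != 0].
  move=> la; have h := ltW (psi_gt2 a); split=> //.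
    case: la => _; apply: contraTneq => ->; rewrite subrr cmod0 -ltNge //.
  by rewrite -cmod_gt0; apply: lt_trans (psi_gt2 a).
have large_upto (r : rat) : 0 < r <= N%:R -> large psi' mu rho delta r.
  move=> /stern_brocot_upto_mem [k _ /(_ k (leqnn k))] /=.
  elim: {-2}N (leqnn N) => [//|n IHn] nN /=.
  rewrite mem_cat mem_rcons inE => /or3P[/(IHn (ltnW nN)) //|/eqP ->|].
    exact: (admissible_r (roots n nN)).
  exact: (stern_brocot_large rho1 delta_le psi_tree_left psi_tree_right (roots n nN)).
have F_le (r : rat) : 0 < r <= N%:R -> cmod (F r) <= B * K1 / (denq r)%:~R ^+ 4.
  move=> /large_upto lr; have [r2 _ _] := large_neq r lr.
  apply: le_trans (hB _ r2 lr.2) _; rewrite -mulrA ler_wpM2l //.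
  exact: hK1.
split; first exact: rat_partial_sum_cvg F_le.
apply: (@cexp_rat_sum R psi' G p D H (admissible psi' mu rho delta) (K2 * K1)) F_le _.
- by move=> a b w [].
- exact: left.
- exact: right.
- move=> a b w adm; have [_ _ lm] := med _ _ _ _ _ adm.
  have [_ _ a0] := large_neq _ (admissible_l adm).
  have [_ _ b0] := large_neq _ (admissible_r adm).
  have [_ _] := large_neq _ lm.
  have -> : psi' (mediant a b) = psi' a * psi' b - w.
    by rewrite (admissible_next adm) addrAC subrr add0r.
  move=> m0; exact: G_vertex (admissible_vertex adm) a0 b0 m0.
- move=> a b w adm.
  have [a2 am _] := large_neq _ (admissible_l adm).
  have [b2 bm _] := large_neq _ (admissible_r adm).
  by have [pa _ _] := pDH a2 am; have [pb _ _] := pDH b2 bm.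
- move=> a b w adm; have [_ _ lm] := med _ _ _ _ _ adm.
  by have [m2 mm _] := large_neq _ lm; have [_ ? ?] := pDH m2 mm.
- move=> a b w adm.
  have la := admissible_l adm; have lb := admissible_r adm.
  apply: le_trans (hK2 _ _ _ (large_cmod_ge rho1 la) (large_cmod_ge rho1 lb)
    (admissible_old adm) (admissible_vertex adm) la.2 lb.2) _.
  rewrite -!mulrA ler_wpM2l //.
  have da := den_ge1 R a; have db := den_ge1 R b.
  (* Take for [c] the end of larger denominator: the weight max(den a, den b) den a den b is then at
     most (den c)^3, which the fourth power from [hK1] beats. *)
  have key (c : rat) (d M : R) : large psi' mu rho delta c -> 0 < d ->
      d <= ((denq c)%:~R : R) ^+ 3 -> cmod (psiq c) <= M -> (M ^+ 2)^-1 <= K1 / d.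
    move=> lc d0 dc cM; have c0 : 0 < cmod (psiq c) by have := psi_gt2 c; lra.
    apply: (@le_trans _ _ (cmod (psiq c) ^+ 2)^-1).
      by rewrite lef_pV2 ?posrE ?exprn_gt0 // ?lerXn2r ?nnegrE //; lra.
    apply: le_trans (hK1 c lc) _; have dc1 := den_ge1 R c.
    rewrite ler_wpM2l // lef_pV2 ?posrE ?exprn_gt0 //; last by lra.
    by apply: le_trans dc _; rewrite [leRHS]exprS ler_peMl // exprn_ge0 //; lra.
  have dmax : 0 < Num.max ((denq a)%:~R : R) (denq b)%:~R by rewrite lt_max; apply/orP; left; lra.
  have d0 : 0 < Num.max ((denq a)%:~R : R) (denq b)%:~R * ((denq a)%:~R * (denq b)%:~R).
    by rewrite !mulr_gt0 //; lra.
  have [ab|ba] := leP ((denq a)%:~R : R) (denq b)%:~R.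
    move: d0 {dmax}; rewrite (max_r ab) => d0; apply: (key b) => //.
      by rewrite exprS expr2 ler_wpM2l ?ler_wpM2r //; lra.
    by rewrite le_max lexx orbT.
  move: d0 {dmax}; rewrite (max_l (ltW ba)) => d0; apply: (key a) => //.
    by rewrite exprS expr2 ler_wpM2l ?ler_wpM2l //; lra.
  by rewrite le_max lexx.
- by rewrite mulr_ge0.
- exact: roots.
- by move=> r /large_upto /large_neq[r2 rm _]; exact: cexp_f.
Qed.

End Gap.
End MarkoffValues.

(** * The two cases of the theorem *)

Section Conclusion.
Variables (R : realType) (mu : R[i]) (phi : Omega -> R[i]) (X : Qinf -> Omega) (s : R).
Hypothesis mu_neq4 : mu != 4.
Hypothesis hphi : markoff_map mu phi.
Hypothesis hX : identification X.
Hypothesis hOmega2 : Omega2 phi = [set X None].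
Hypothesis s_itv : -2 < s < 2.
Hypothesis phi_inf : phi (X None) = s%:C.

Let x := phi (X None).
Let y n := phi (X (Some n%:R)).

Definition gap_conclusion (F : rat -> R[i]) : Prop :=
  [/\ forall N : nat, cvg (rat_partial_sum F N @ totally),
      (fun N : nat => complex.Re (rat_sum F N / N%:R)) @ \oo --> (0 : R) &
      exists Nk : nat -> nat,
        [/\ forall k, (0 < Nk k)%N,
            forall i j, (i < j)%N -> (Nk i < Nk j)%N &
            (fun k : nat => to_mod_2pii (rat_sum F (Nk k))) @ \oo -->
              to_mod_2pii (0 : R[i])]].

Let conclusion_of_potential (F : rat -> R[i]) (ratio V : nat -> R[i]) :
  (forall N : nat, cvg (rat_partial_sum F N @ totally) /\
     cexp (rat_sum F N) = \prod_(0 <= n < N) ratio n) ->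
  potential y ratio V -> gap_conclusion F.
Proof.
move=> FN [ratioV [c [C [c0 VcC]]] Vcvg].
have Vn0 n : V n != 0.
  by rewrite -cmod_gt0; have /andP[h _] := VcC n; apply: lt_le_trans h.
have E N : cexp (rat_sum F N) = V N / V 0%N.
  rewrite (FN N).2; elim: N => [|N IHN]; first by rewrite big_nil divff.
  by rewrite big_nat_recr //= IHN ratioV; field; rewrite !Vn0.
have yr n : s%:C * y n.+1 = y n + y n.+2.
  by rewrite -phi_inf; exact: y_rec hphi hX n.
have [Nk [N0 Ninc c1 c2]] := quasiperiodic_recurrent s_itv yr.
split; first by move=> N; exact: (FN N).1.
  exact: cvg_Re_rat_sum_div c0 VcC E.
exists Nk; split => //.
by apply: (cvg_rat_sum_mod_2pii c0 VcC E); exact: Vcvg c1 c2.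
Qed.

Let y_bounded : exists M : R, forall n, cmod (y n) <= M.
Proof.
apply: (quasiperiodic_bounded s_itv) => n.
by rewrite -phi_inf; exact: y_rec hphi hX n.
Qed.

Let y_gt2 n : 2 < cmod (y n).
Proof. exact: psi_gt2 hX hOmega2 _. Qed.

Let delta_gt0 : 0 < 4 - s ^+ 2.
Proof. by have /andP[? ?] := s_itv; nra. Qed.

Lemma conclusion_parabolic : mu = 0 ->
  gap_conclusion (fun r => hfun (phi (X (Some r)))).
Proof.
move=> mu0; have [M yM] := y_bounded.
have [V hV] := parabolic_potential (y_rec hphi hX) (y_vertex hphi hX) y_gt2 yM mu0.
apply: conclusion_of_potential hV => N.
apply: (gap_rat_sum hphi hX hOmega2 s_itv phi_inf
  (G := fun a b w => cexp (w / (a * b) / 2)) (p := fun z => cexp (hfun z / 2))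
  (D := fun=> 1) (H := fun z => cexp (hfun z))) => //.
- move=> rho delta rho1 _; pose E := edge_const mu (2 * rho).
  have E0 : 0 <= E.
    have e1 : 0 <= 1 + cmod mu / 4 by rewrite addr_ge0 ?divr_ge0 ?cmod_ge0.
    have e2 : 0 <= 1 / 2 - 1 / (2 * rho).
      by rewrite subr_ge0 !mul1r lef_pV2 ?posrE //; lra.
    by rewrite /E /edge_const addr_ge0 // divr_ge0.
  (* From [cmod_cexpB1_le] at an exponent [u] with |u| <= E/W <= E. *)
  exists (3 * E * expR E) => [|a b w ra rb wab vert _ _].
    by rewrite !mulr_ge0 ?expR_ge0.
  have rho2 : 2 < 2 * rho by lra.
  have := hfun2_near_edge rho2 ra rb wab vert; rewrite -/E.
  have M2 : 1 <= Num.max (cmod a) (cmod b) ^+ 2.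
    by rewrite exprn_ege1 // le_max; apply/orP; left; lra.
  move: M2; set W := _ ^+ 2 => W1; set c := w / (a * b) => ec.
  have -> : cexp (c / 2) / (cexp (hfun a / 2) * cexp (hfun b / 2)) =
      cexp ((c - (hfun a + hfun b)) / 2).
    by rewrite -cexpD -cexpB; congr cexp; field.
  set u := (c - _) / 2.
  have cu : cmod u <= E / W.
    rewrite /u cmod_div cmod_nat ler_pdivrMr //.
    have : 0 <= E / W by rewrite divr_ge0 //; lra.
    lra.
  have EW : E / W <= E by rewrite ler_pdivrMr ?ler_peMr //; lra.
  apply: le_trans (cmod_cexpB1_le _) _.
  have -> : 3 * E * expR E / W = 3 * (E / W) * expR E by ring.
  apply: ler_pM; rewrite ?expR_ge0 ?mulr_ge0 ?cmod_ge0 ?ler_wpM2l //.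
  by rewrite ler_expR; lra.
(* For mu = 0 and m = ab - w one has w m = a^2 + b^2, so w/(ab) = b/(am) + a/(mb): the vertex
   relation becomes additive in the exponent. *)
- move=> a b w vert a0 b0 m0; rewrite mulr1 -cexpD; congr cexp.
  have E : w * (a * b - w) = a ^+ 2 + b ^+ 2.
    by apply/eqP; rewrite -subr_eq0 -oppr_eq0 -mu0 -vert; apply/eqP; ring.
  have -> : w / (a * b) / 2 = w * (a * b - w) / (a * b * (a * b - w)) / 2.
    by field; rewrite a0 b0 m0.
  by rewrite E; field; rewrite a0 b0 m0.
- move=> z _ _; rewrite cexp_neq0 oner_neq0; split=> //.
  by rewrite divr1 expr2 -cexpD; congr cexp; field.
- by move=> delta _; exists 2 => // z _ _; exact: cmod_hfun_le.
Qed.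

Lemma conclusion_hyperbolic : mu != 0 ->
  gap_conclusion (fun r => hfun_tau (mu - 2) (phi (X (Some r)))).
Proof.
move=> mu0; have [M yM] := y_bounded.
pose nu := cacosh (- (mu - 2) / 2); pose t := cexp nu.
have t0 : t != 0 := cexp_neq0 nu.
have t_mu : t + t^-1 = 2 - mu.
  have : (t + t^-1) / 2 = - (mu - 2) / 2.
    by rewrite -[RHS]cacoshK /ccosh cexpN.
  by move=> /(mulIf _) ->; [ring | rewrite invr_eq0 pnatr_eq0].
have tauE z : hfun_tau (mu - 2) z = clog (pfun t z / pfun t^-1 z).
  by rewrite /hfun_tau /pfun -/nu -cexpN.
have [V hV] := hyperbolic_potential mu_neq4 (y_rec hphi hX) (y_vertex hphi hX)
  y_gt2 yM delta_gt0 (y_delta hphi hX hOmega2 phi_inf) mu0 t0 t_mu.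
apply: conclusion_of_potential hV => N.
have pq z : 2 <= cmod z -> z ^+ 2 != mu ->
    [/\ z != 0, 1 - mu / z ^+ 2 != 0, pfun t z != 0 & pfun t^-1 z != 0].
  move=> z2 zmu; have z0 : z != 0 by rewrite -cmod_gt0; lra.
  have D0 : 1 - mu / z ^+ 2 != 0.
    have -> : 1 - mu / z ^+ 2 = (z ^+ 2 - mu) / z ^+ 2 by field.
    by rewrite mulf_neq0 ?invr_eq0 ?expf_neq0 // subr_eq0.
  by split=> //; move: D0; rewrite -(pfunM_inv t0 t_mu z0) mulf_eq0 negb_or => /andP[].
apply: (gap_rat_sum hphi hX hOmega2 s_itv phi_inf (G := Gfun t) (p := pfun t)
  (D := fun z => 1 - mu / z ^+ 2) (H := fun z => pfun t z / pfun t^-1 z)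
  (f := hfun_tau (mu - 2))).
- move=> rho delta rho1 delta0; exact: (Gfun_near t0 t_mu delta0 rho1).
- move=> a b w; exact: (Gfun_vertex t0 t_mu).
- move=> z z2 zmu; have [z0 D0 p0 q0] := pq z z2 zmu; split=> //.
  by rewrite -(pfunM_inv t0 t_mu z0); field; rewrite p0 q0.
- move=> delta delta0; have [B B0 hB] := clog_gap_le t0 t_mu delta0.
  by exists B => // z z2 dz; rewrite tauE; exact: hB.
- move=> z z2 zmu; have [z0 D0 p0 q0] := pq z z2 zmu.
  by rewrite tauE clogK // mulf_neq0 // invr_eq0.
Qed.

End Conclusion.

Theorem theorem2p6 (R : realType) (mu : R[i]) (phi : Omega -> R[i])
    (X : Qinf -> Omega)
    (hmu : mu <> 4)
    (hphi : markoff_map mu phi)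
    (hX : identification X)
    (hOmega2 : Omega2 phi = [set X None])
    (hreal : exists2 t : R, -2 < t < 2 & phi (X None) = t%:C) :
  let F := fun r : rat => frakh mu (phi (X (Some r))) in
  [/\ forall N : nat, cvg (rat_partial_sum F N @ totally),
      (fun N : nat => complex.Re (rat_sum F N / N%:R)) @ \oo --> (0 : R) &
      exists Nk : nat -> nat,
        [/\ forall k, (0 < Nk k)%N,
            forall i j, (i < j)%N -> (Nk i < Nk j)%N &
            (fun k : nat => to_mod_2pii (rat_sum F (Nk k))) @ \oo -->
              to_mod_2pii (0 : R[i])]].
Proof.
move=> F; have [s s_itv phi_inf] := hreal; have /eqP mu4 := hmu.
rewrite /F /frakh; have [mu0|mu0] := eqVneq mu 0.
  exact: (conclusion_parabolic hphi hX hOmega2 s_itv phi_inf mu0).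
exact: (conclusion_hyperbolic mu4 hphi hX hOmega2 s_itv phi_inf mu0).
Qed.
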